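(* Let $\theta>0$, $\alpha>-1$, and put $\tilde\alpha=\frac{\alpha+1}{\theta}-1$, $\tilde\theta=\frac1\theta$. Then the asymptotic behaviour of the biorthogonal Laguerre ensemble at the left edge of the spectrum is invariant under the change of parameters $(\alpha,\theta)\mapsto(\tilde\alpha,\tilde\theta)$ combined with the transformation $x\mapsto x^{\frac1\theta}$ of the phase space $(0,+\infty)$. That is, for every $n\ge1$, the image of the measure $\rho^{Lag(\tilde\alpha,\tilde\theta)}_n(x_1,\ldots,x_n)\,dx_1\cdots dx_n$ on $(0,+\infty)^n$ under the map $(x_1,\ldots,x_n)\mapsto(x_1^{1/\theta},\ldots,x_n^{1/\theta})$ is the measure $\rho^{Lag(\alpha,\theta)}_n(x_1,\ldots,x_n)\,dx_1\cdots dx_n$.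
   Context: For $\theta>0$, $\alpha>-1$, the $N$-point biorthogonal Laguerre ensemble on $(0,+\infty)$ has joint probability density $$p^{Lag}_N(x_1,\ldots,x_N)=\mathrm{const}\cdot\prod_{1\le i<j\le N}\left[(x_i-x_j)(x_i^{\theta}-x_j^{\theta})\right]\cdot\prod_{i=1}^N x_i^{\alpha}\cdot e^{-x_1-\cdots-x_N}$$ (total integral $1$), with correlation functions $\rho^{Lag}_{nN}(x_1,\ldots,x_n)=\frac{N!}{(N-n)!}\int_{(0,\infty)^{N-n}}p^{Lag}_N\,dx_{n+1}\cdots dx_N$. The limit correlation functions at the left edge of the spectrum are $$\rho_n^{Lag(\alpha,\theta)}(x_1,\ldots,x_n)=\lim_{N\to\infty}\frac1{N^{n/\theta}}\rho^{Lag}_{nN}\left(\frac{x_1}{N^{1/\theta}},\ldots,\frac{x_n}{N^{1/\theta}}\right)=\prod_{i=1}^n x_i^{\alpha}\cdot\det\left[\mathcal K^{(\alpha,\theta)}(x_i,x_j)\right]_{i,j=1}^n,$$ $$\mathcal K^{(\alpha,\theta)}(x,y)=\sum_{k,l=0}^{\infty}\frac{(-1)^{k}x^{k}}{k!\,\Gamma\left(\frac{\alpha+1+k}{\theta}\right)}\,\frac{(-1)^l y^{\theta l}}{l!\,\Gamma(\alpha+1+\theta l)}\,\frac{\theta}{\alpha+1+k+\theta l}.$$ *)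

(* Defs.v *)
From HB Require Import structures.
From mathcomp Require Import all_boot all_order all_algebra.
From mathcomp Require Import all_classical all_reals all_analysis.

Set Implicit Arguments.
Unset Strict Implicit.
Unset Printing Implicit Defensive.

Import Order.TTheory GRing.Theory Num.Theory.
Import numFieldNormedType.Exports.

Local Open Scope classical_set_scope.
Local Open Scope ring_scope.

Section cons_measure.
Context d (T : measurableType d) (R : realType) (n : nat).
Variables (m1 : {sigma_finite_measure set T -> \bar R})
  (m2 : {sigma_finite_measure set (n.-tuple T) -> \bar R}).

Definition tuple_cons (p : T * n.-tuple T) : n.+1.-tuple T :=
  [tuple of p.1 :: p.2].

Lemma measurable_tuple_cons : measurable_fun setT tuple_cons.
Proof.
exact: (@measurable_cons _ _ _ _ fst n snd measurable_fst measurable_snd).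
Qed.

(* The product m1 \x m2, transported along T * T^n = T^(n+1). *)
Definition cons_measure : set (n.+1.-tuple T) -> \bar R :=
  pushforward (m1 \x m2)%E tuple_cons.

Let cons_measure0 : cons_measure set0 = 0%E.
Proof. by rewrite /cons_measure /pushforward preimage_set0 measure0. Qed.

Let cons_measure_ge0 A : (0 <= cons_measure A)%E.
Proof. exact: (measure_ge0 (m1 \x m2)%E). Qed.

Let cons_measure_sigma_additive : semi_sigma_additive cons_measure.
Proof.
rewrite /cons_measure => F mF tF mUF.
rewrite /pushforward preimage_bigcup.
have mpre B : measurable B -> measurable (tuple_cons @^-1` B).
  by move=> mB; rewrite -[X in measurable X]setTI; exact: measurable_tuple_cons.
apply: measure_semi_sigma_additive.
- by move=> i; exact: mpre.
- apply/trivIsetP => /= i j _ _ ij; rewrite -preimage_setI.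
  by move/trivIsetP : tF => /(_ _ _ _ _ ij) ->//; rewrite preimage_set0.
- by rewrite -preimage_bigcup; exact: mpre.
Qed.

HB.instance Definition _ := isMeasure.Build _ _ _ cons_measure
  cons_measure0 cons_measure_ge0 cons_measure_sigma_additive.

Let cons_measure_sigma_finite : sigma_finite setT cons_measure.
Proof.
have /sigma_finiteP[F [TF ndF Foo]] := sigma_finiteT m1.
have /sigma_finiteP[G [TG ndG Goo]] := sigma_finiteT m2.
pose hd (t : n.+1.-tuple T) : T := thead t.
pose tl (t : n.+1.-tuple T) : n.-tuple T := [tuple of behead t].
exists (fun k => hd @^-1` F k `&` tl @^-1` G k).
  apply/seteqP; split=> // t _.
  have [i _ Fi] : (\bigcup_i F i) (hd t) by rewrite -TF.
  have [j _ Gj] : (\bigcup_i G i) (tl t) by rewrite -TG.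
  exists (maxn i j) => //; split => /=.
    by move: (hd t) Fi; exact/subsetPset/ndF/leq_maxl.
  by move: (tl t) Gj; exact/subsetPset/ndG/leq_maxr.
move=> k; have [mF Ffin] := Foo k; have [mG Gfin] := Goo k; split.
  apply: measurableI; rewrite -[X in measurable X]setTI.
    exact: (measurable_tnth ord0).
  exact: measurable_behead.
rewrite /cons_measure /pushforward.
have -> : tuple_cons @^-1` (hd @^-1` F k `&` tl @^-1` G k) = F k `*` G k.
  apply/seteqP; split=> -[a t] /=; rewrite /hd /tl theadE /=;
    by rewrite (_ : [tuple of behead (a :: t)] = t)//; exact/val_inj.
by rewrite product_measure1E// lte_mul_pinfty// ge0_fin_numE.
Qed.

HB.instance Definition _ := Measure_isSigmaFinite.Build _ _ _ cons_measure
  cons_measure_sigma_finite.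

End cons_measure.

(* Product Lebesgue measure, along R^(n+1) = R * R^n; the one-point space R^0
   has mass 1. *)
Fixpoint lebesgue_tuple (R : realType) (n : nat) :
    {sigma_finite_measure set (n.-tuple (measurableTypeR R)) -> \bar R} :=
  match n with
  | 0 => \d_ [tuple of [::]]
  | m.+1 => cons_measure lebesgue_measure (lebesgue_tuple R m)
  end.

Definition orthant (R : realType) (n : nat) :
    set (n.-tuple (measurableTypeR R)) :=
  [set x | forall i, 0 < (tnth x i : R)].
Arguments orthant : clear implicits.

Section biorthogonal_Laguerre_ensemble.
Variables (R : realType) (alpha theta : R).
Implicit Types n N : nat.

Definition Lag_weight n (x : n.-tuple R) : R :=
  (\prod_(i < n) \prod_(j < n | (i < j)%N)
    ((tnth x i - tnth x j) * (tnth x i `^ theta - tnth x j `^ theta)))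
  * (\prod_(i < n) tnth x i `^ alpha) * expR (- \sum_(i < n) tnth x i).

(* The normalising constant makes the total integral over (0,+oo)^N equal
   to 1. *)
Definition Lag_density N (x : N.-tuple R) : R :=
  (\int[lebesgue_tuple R N]_(y in orthant R N) Lag_weight y)^-1 * Lag_weight x.

(* Meaningful for n <= N, where x ++ y is a point of dimension
   n + (N - n) = N; smaller N play no role in the limit below. *)
Definition Lag_correlation n N (x : n.-tuple R) : R :=
  N`!%:R / (N - n)`!%:R *
  \int[lebesgue_tuple R (N - n)]_(y in orthant R (N - n))
    Lag_density [tuple of x ++ y].

Definition Lag_edge_correlation n (x : n.-tuple R) : R :=
  limn (fun N => (N%:R `^ (n%:R / theta))^-1 *
    Lag_correlation N (map_tuple (fun t => t / N%:R `^ theta^-1) x)).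

(* The measure rho_n(x) dx on (0,+oo)^n, viewed as a measure on R^n carried by
   the orthant: only the values on the orthant of a map on R^n matter for the
   image of this measure. *)
Definition Lag_edge_measure n (A : set (n.-tuple (measurableTypeR R))) :
    \bar R :=
  (\int[lebesgue_tuple R n]_(x in A `&` orthant R n)
    (Lag_edge_correlation x)%:E)%E.

End biorthogonal_Laguerre_ensemble.

(* Main.v *)
Require Import Defs.
From HB Require Import structures.
From mathcomp Require Import all_boot all_order all_algebra all_fingroup.
From mathcomp Require Import all_classical all_reals all_analysis.
From mathcomp Require Import measurable_realfun ring lra.
Import Order.TTheory GRing.Theory Num.Theory.
Import numFieldNormedType.Exports.
Local Open Scope classical_set_scope.
Local Open Scope ring_scope.

(** The symmetry belongs to the limit only. The substitution x = y^theta turns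
    the weight e^(-x) of the ensemble with the new parameters into
    e^(-y^theta), so that the finite ensembles are not images of one another.
    The proof therefore computes the limit correlation functions and reads the
    symmetry off the limit kernel.

    Finite ensembles. The density is a constant times
    det[x_k^i] det[x_k^(theta i)] prod_k x_k^alpha e^(-x_k). When the monomials
    x^i are replaced by the polynomials dual to the functions x^(theta j), the
    first determinant only changes by a constant factor, and expanding both
    determinants and integrating out the last variables leaves a determinant
    of the kernel sum_l (dual polynomial l)(x) y^(theta l); this is
    [biorthogonal_marginal]. The dual polynomials come from the inverse of the
    Gram matrix Gamma(alpha + 1 + i + theta j), which is explicit: dividing by
    Gamma(alpha + 1 + theta j) turns its i-th row into rising factorials of
    length i, and these are the basis functions of a Newton series. The series
    of a polynomial which vanishes at all but one of the points 0, -1, ...,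
    -(N - 1) then gives [inverse_GramP].

    The limit. After rescaling by N^(1/theta), the coefficient of
    x^i y^(theta l) is a sum of i + 1 terms; up to factors that tend to
    constants, each is the ratio of a rising factorial to its asymptotic size
    times a power of N. By Euler's product for 1/Gamma
    ([rising_asymptotic]) only one term survives, and it gives the coefficient
    of the limit kernel K. The bound [rising_le] on rising factorials has
    the same power of N and is explicit in the argument, so the double sums
    are dominated ([dominated_square_sums]) and the limit can be taken term by
    term ([rescaled_correlation_cvg]).

    The symmetry. With z_i = (alpha + 1 + i) / theta and
    s_l = alpha + 1 + theta l the kernel is
<<
      K(x, y) = sum_(i, l) (-1)^(i + l) x^i y^(theta l)
                           / (i! Gamma(z_i) l! Gamma(s_l) (z_i + l)).
>>
    The change of parameters exchanges the two families z and s, and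
    z_i + l = (s_l + i) / theta; hence the new kernel at (x^theta, y^theta) is
    K(y, x) / theta ([edge_kernel_swap]). The determinant does not see the
    transposition, and the factor theta^(-n) together with the change of the
    power prefactor is exactly compensated by the Jacobian of y = x^theta
    ([edge_correlation_swap], [ge0_integral_lebesgue_tuple_power]). *)

(** * Euler's Gamma function *)
Section Gamma_function.
Variable R : realType.
Implicit Types s t x : R.
Notation mu := (@lebesgue_measure R).

Definition positive_reals : set R := `]0, +oo[%classic.

Lemma integral_powR_compact (s a b : R) : 0 < a -> a < b ->
  (\int[mu]_(u in `[a, b]) (s * u `^ (s - 1))%:E = (b `^ s - a `^ s)%:E)%E.
Proof.
move=> a0 ab.
have sub u : u \in `[a, b] -> 0 < u.
  by rewrite in_itv/= => /andP[+ _]; exact: lt_le_trans.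
have cts (r u : R) : 0 < u -> {for u, continuous (fun x : R => x `^ r)}.
  move=> u0; apply/differentiable_continuous/derivable1_diffP.
  by apply: derivable_powR; rewrite in_itv/= u0.
rewrite (@continuous_FTC2 _ _ (fun x => x `^ s))//.
- apply: derivable_within_continuous => u /sub u0.
  by apply: derivableM => //; apply: derivable_powR; rewrite in_itv/= u0.
- split.
  + move=> u uab; apply: derivable_powR; rewrite in_itv/= andbT.
    by apply: sub; apply: subset_itv_oo_cc uab.
  + exact/cvg_at_right_filter/cts.
  + by apply/cvg_at_left_filter/cts; exact: lt_trans ab.
- move=> u uab; rewrite powR_derive1// in_itv/= andbT.
  by apply: sub; apply: subset_itv_oo_cc uab.
Qed.

Lemma measurable_powR_density s (D : set R) :
  measurable_fun D (EFin \o (fun u : R => s * u `^ (s - 1))).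
Proof.
apply/measurable_funTS/measurable_EFinP/measurable_funM => //.
Qed.

(** For s < 1 the integrand is unbounded at 0, so the fundamental theorem only
    applies on [b / (n + 2), b]; monotone convergence does the rest. *)
Lemma integral_powR (s b : R) : 0 < s -> 0 < b ->
  (\int[mu]_(u in `]0%R, b]) (s * u `^ (s - 1))%:E = (b `^ s)%:E)%E.
Proof.
move=> s0 b0.
have -> : `]0, b]%classic = \bigcup_n `]b * n.+2%:R^-1, b]%classic :> set R.
  apply/seteqP; split=> [u|u [n _]] /=; rewrite !in_itv/=.
    move=> /andP[u0 ub]; have [n] := ltr_add_invr (divr_gt0 u0 b0).
    rewrite add0r => nu; exists n => //=; rewrite in_itv/= ub andbT.
    rewrite mulrC -ltr_pdivlMr//; apply: le_lt_trans nu.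
    by rewrite lef_pV2 ?posrE ?ltr0n// ler_nat.
  move=> /andP[nu ->]; rewrite andbT; apply: le_lt_trans nu.
  by rewrite mulr_ge0// ltW.
have H := @ge0_nondecreasing_set_cvg_integral _ (measurableTypeR R) R
  (fun n => `]b * n.+2%:R^-1, b]%classic) (fun u : R => (s * u `^ (s - 1))%:E) mu.
have nd : nondecreasing_seq (fun n => `]b * n.+2%:R^-1, b]%classic : set R).
  move=> m n mn; apply/subsetPset => u /=; rewrite !in_itv/= => /andP[+ ->].
  rewrite andbT; apply: le_lt_trans.
  by rewrite ler_pM2l// lef_pV2 ?posrE ?ltr0n// ler_nat !ltnS.
have g0 n (u : R) : `]b * n.+2%:R^-1, b]%classic u -> (0 <= (s * u `^ (s - 1))%:E)%E.
  by move=> _; rewrite lee_fin mulr_ge0 ?powR_ge0// ltW.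
have {H nd g0} := H nd (fun=> measurable_itv _) (fun=> @measurable_powR_density s _)
  g0.
move=> H.
apply: (cvg_unique (@ereal_hausdorff R) H).
have -> : (fun n => \int[mu]_(x in `](b * n.+2%:R^-1)%R, b])
   (s * x `^ (s - 1))%:E)%E = (fun n => (b `^ s - (b * n.+2%:R^-1) `^ s)%:E).
  apply/funext => n; rewrite integral_itv_obnd_cbnd; last first.
    exact: measurable_powR_density.
  rewrite integral_powR_compact//; first by rewrite mulr_gt0// invr_gt0.
  by rewrite gtr_pMr// invf_lt1// ltr1n.
apply: cvg_EFin; first exact: nearW.
rewrite -[X in _ --> X]subr0; apply: cvgB; first exact: cvg_cst.
move/cvg_at_rightP : (powR_cvg0 s0); apply; split.
  by move=> n; rewrite mulr_gt0// invr_gt0.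
rewrite -[X in _ --> X](mulr0 b); apply: cvgMr.
have := @cvg_harmonic R; rewrite -(cvg_shiftS (@harmonic R)).
exact.
Qed.

Lemma integral_expRN (u : R) :
  (\int[mu]_(t in `[u, +oo[) (expR (- t))%:E = (expR (- u))%:E)%E.
Proof.
have ce : continuous (fun t : R => - expR (- t)).
  move=> t; apply: cvgN; apply: continuous_comp; last exact: continuous_expR.
  exact: cvgN.
rewrite (@ge0_continuous_FTC2y _ _ (fun t => - expR (- t)) _ 0)//.
- by rewrite EFinN oppeK add0e.
- apply: continuous_subspaceT => t.
  apply: continuous_comp; last exact: continuous_expR.
  exact: cvgN.
- by rewrite -oppr0; apply: cvgN; exact: cvgr_expR.
- exact/cvg_at_right_filter/ce.
- move=> t _; rewrite derive1E derive_val.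
  by rewrite /GRing.scale/= mulrN1 opprK.
Qed.

Definition gamma_fun (s t : R) : R := t `^ (s - 1) * expR (- t).

(** The extended value serves until finiteness is known, because Tonelli's
    theorem gives the functional equation without it. *)
Definition eGamma (s : R) : \bar R :=
  (\int[mu]_(t in positive_reals) (gamma_fun s t)%:E)%E.
Definition Gamma (s : R) : R := fine (eGamma s).

Lemma measurable_gamma_fun s (D : set R) : measurable_fun D (gamma_fun s).
Proof.
apply/measurable_funTS/measurable_funM; first exact: measurable_powR.
by apply: measurableT_comp => //; exact: measurableT_comp.
Qed.

Lemma gamma_fun_ge0 s t : 0 <= gamma_fun s t.
Proof. by rewrite mulr_ge0 ?powR_ge0 ?expR_ge0. Qed.

(** Tonelli for the function s u^(s - 1) e^(-t) on 0 < u <= t: integrating over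
    t first gives s Gamma(s), and over u first gives Gamma(s + 1). *)
Lemma eGammaS s : 0 < s -> eGamma (s + 1) = (s%:E * eGamma s)%E.
Proof.
move=> s0.
pose f (p : R * R) : \bar R :=
  (if (0 < p.1) && (p.1 <= p.2) then s * p.1 `^ (s - 1) * expR (- p.2)
   else 0)%:E.
have f0 p : (0 <= f p)%E.
  by rewrite lee_fin; case: ifP => // _; rewrite !mulr_ge0 ?powR_ge0 ?expR_ge0// ltW.
have mf : measurable_fun setT f.
  apply/measurable_EFinP; apply: measurable_fun_ifT => //.
    apply: measurable_and; first exact: measurable_fun_ltr.
    exact: measurable_fun_ler.
  apply: measurable_funM.
    apply: measurable_funM => //.
    by apply: (measurableT_comp (measurable_powR _)).
  by apply: measurableT_comp => //; exact: measurableT_comp.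
have := @fubini_tonelli _ _ (measurableTypeR R) (measurableTypeR R) R mu mu f mf f0.
have -> : (\int[mu]_x \int[mu]_y f (x, y) = s%:E * eGamma s)%E.
  rewrite /eGamma -ge0_integralZl//; last 4 first.
  - exact: measurable_itv.
  - by apply/measurable_EFinP; exact: measurable_gamma_fun.
  - by move=> t _; rewrite lee_fin gamma_fun_ge0.
  - by rewrite lee_fin ltW.
  rewrite [RHS]integral_mkcond; apply: eq_integral => u _.
  rewrite patchE; case: ifPn => [|]; rewrite /positive_reals.
    rewrite inE/= in_itv/= andbT => u0.
    rewrite -EFinM /gamma_fun mulrA EFinM -integral_expRN.
    rewrite -ge0_integralZl//; last 2 first.
    - apply/measurable_EFinP/measurable_funTS.
      by apply: measurableT_comp => //; exact: measurableT_comp.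
    - by rewrite lee_fin mulr_ge0 ?powR_ge0// ltW.
    rewrite [RHS]integral_mkcond; apply: eq_integral => t _.
    rewrite patchE /f/= u0/= mem_setE in_itv/= andbT.
    by case: ifP => // _; rewrite EFinM.
  move=> u0; apply: integral0_eq => t _.
  rewrite /f/= ifF//; apply/negbTE; apply: contra u0 => /andP[u0 _].
  by rewrite inE/= in_itv/= u0.
move=> ->; rewrite /eGamma [LHS]integral_mkcond; apply: eq_integral => t _.
rewrite patchE; case: ifPn => [|]; rewrite /positive_reals.
  rewrite inE/= in_itv/= andbT => t0.
  rewrite /gamma_fun addrK EFinM -integral_powR// muleC -ge0_integralZl//;
    last 2 first.
  - exact: measurable_powR_density.
  - by move=> u _; rewrite lee_fin mulr_ge0 ?powR_ge0// ltW.
  rewrite [LHS]integral_mkcond; apply: eq_integral => u _.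
  rewrite patchE /f/= mem_setE in_itv/=.
  by case: ifP => // _; rewrite -EFinM mulrC.
move=> t0; apply/esym/integral0_eq => u _.
rewrite /f/= ifF//; apply: contraNF t0 => /andP[u0 ut].
by rewrite inE/= in_itv/= andbT (lt_le_trans u0).
Qed.

(** The exponential is at least e^(-1) on (0, 1]. *)
Lemma eGamma_ge s : 0 < s -> ((expR (-1) / s)%:E <= eGamma s)%E.
Proof.
move=> s0; apply: (@le_trans _ _
    (\int[mu]_(t in `]0%R, 1%R]) ((expR (-1) / s)%:E * (s * t `^ (s - 1))%:E))%E).
  rewrite ge0_integralZl//; last 3 first.
  - exact: measurable_powR_density.
  - by move=> u _; rewrite lee_fin mulr_ge0 ?powR_ge0// ltW.
  - by rewrite lee_fin divr_ge0 ?expR_ge0// ltW.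
  by rewrite integral_powR// powR1 mule1.
apply: (@le_trans _ _ (\int[mu]_(t in `]0%R, 1%R]) (gamma_fun s t)%:E)%E).
  apply: ge0_le_integral => //=.
  - by move=> t _; rewrite lee_fin !mulr_ge0 ?invr_ge0 ?powR_ge0 ?expR_ge0// ltW.
  - by apply: measurable_funeM; exact: measurable_powR_density.
  - by apply/measurable_EFinP; exact: measurable_gamma_fun.
  - move=> t; rewrite in_itv/= => /andP[t0 t1].
    rewrite -EFinM lee_fin mulrA divfK ?gt_eqF// mulrC ler_wpM2l ?powR_ge0//.
    by rewrite ler_expR lerN2.
apply: ge0_subset_integral => //=.
- exact: measurable_itv.
- by apply/measurable_EFinP; exact: measurable_gamma_fun.
- by move=> t _; rewrite lee_fin gamma_fun_ge0.
- by move=> t; rewrite /positive_reals/= !in_itv/= => /andP[->].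
Qed.

(** The functional equation lowers s until s <= 1; there the integrand is at
    most t^(s - 1) for t <= 1 and at most e^(-t) for t >= 1. *)
Lemma eGamma_lty s : 0 < s -> (eGamma s < +oo)%E.
Proof.
move=> s0; have [n sn] : exists n : nat, s <= n%:R.
  exists (Num.truncn s).+1; rewrite ltW//.
  exact: real_truncnS_gt (ger0_real (ltW s0)).
elim: n s s0 sn => [|n IH] s s0 sn; first by have := lt_le_trans s0 sn; rewrite ltxx.
have [s1|s1] := leP s 1; last first.
  rewrite -[s](subrK 1) eGammaS ?subr_gt0// lte_mul_pinfty ?lee_fin ?subr_ge0
    ?(ltW s1)//.
  by apply: IH; [rewrite subr_gt0 | rewrite lerBlDr natr1].
have -> : eGamma s = (\int[mu]_(t in `]0%R, 1%R]) (gamma_fun s t)%:E +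
   \int[mu]_(t in `]1%R, +oo[) (gamma_fun s t)%:E)%E.
  rewrite -ge0_integral_setU//=.
  - by rewrite -itv_bndbnd_setU// bnd_simp.
  - by apply/measurable_EFinP; exact: measurable_gamma_fun.
  - by move=> t _; rewrite lee_fin gamma_fun_ge0.
  - apply/disj_setPS => t [] /=; rewrite !in_itv/= => /andP[_ t1] /andP[t1' _].
    by have := lt_le_trans t1' t1; rewrite ltxx.
rewrite lte_add_pinfty//.
  apply: (@le_lt_trans _ _ (\int[mu]_(t in `]0%R, 1%R])
    ((s^-1)%:E * (s * t `^ (s - 1))%:E))%E).
    apply: ge0_le_integral => //=.
    - by move=> t _; rewrite lee_fin gamma_fun_ge0.
    - by apply/measurable_EFinP; exact: measurable_gamma_fun.
    - by apply: measurable_funeM; exact: measurable_powR_density.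
    - move=> t; rewrite in_itv/= => /andP[t0 t1].
      rewrite -EFinM lee_fin mulrA mulVf ?gt_eqF// mul1r.
      by rewrite ler_piMr ?powR_ge0// -expR0 ler_expR lerNl oppr0 ltW.
  rewrite ge0_integralZl//; last 3 first.
  - exact: measurable_powR_density.
  - by move=> u _; rewrite lee_fin mulr_ge0 ?powR_ge0// ltW.
  - by rewrite lee_fin invr_ge0 ltW.
  by rewrite integral_powR// powR1 mule1 ltry.
apply: (@le_lt_trans _ _ (\int[mu]_(t in `[1%R, +oo[) (expR (- t))%:E)%E).
  apply: (@le_trans _ _ (\int[mu]_(t in `]1%R, +oo[) (expR (- t))%:E)%E).
    apply: ge0_le_integral => //=.
    - by move=> t _; rewrite lee_fin gamma_fun_ge0.
    - by apply/measurable_EFinP; exact: measurable_gamma_fun.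
    - apply/measurable_EFinP/measurable_funTS.
      by apply: measurableT_comp => //; exact: measurableT_comp.
    - move=> t; rewrite in_itv/= andbT => t1.
      rewrite lee_fin ler_piMl ?expR_ge0//.
      by rewrite -[leRHS](powRr0 t) ler_powR ?(ltW t1)// subr_le0.
  rewrite integral_itv_obnd_cbnd//.
  apply/measurable_EFinP/measurable_funTS.
  by apply: measurableT_comp => //; exact: measurableT_comp.
by rewrite integral_expRN ltry.
Qed.

Lemma eGammaE s : 0 < s -> eGamma s = (Gamma s)%:E.
Proof.
move=> s0; rewrite /Gamma fineK// ge0_fin_numE ?eGamma_lty//.
by apply: integral_ge0 => t _; rewrite lee_fin gamma_fun_ge0.
Qed.

Lemma Gamma_ge s : 0 < s -> expR (-1) / s <= Gamma s.
Proof. by move=> s0; rewrite -lee_fin -eGammaE// eGamma_ge. Qed.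

Lemma Gamma_gt0 s : 0 < s -> 0 < Gamma s.
Proof.
by move=> s0; apply: lt_le_trans (Gamma_ge _ s0); rewrite divr_gt0 ?expR_gt0.
Qed.

Lemma GammaS s : 0 < s -> Gamma (s + 1) = s * Gamma s.
Proof.
move=> s0; have := eGammaS _ s0.
by rewrite !eGammaE// ?addr_gt0// -EFinM => -[].
Qed.

Lemma ln_le_sub1 (x : R) : 0 < x -> ln x <= x - 1.
Proof.
move=> x0; have := @le_ln1Dx R (x - 1).
by rewrite subrKC; apply; rewrite ltrBrDl subrr.
Qed.

(** The graph of the concave function t^s lies below its tangent at c. After
    division by c^s this is the weighted inequality of the means,
    v^s <= 1 - s + s v with v = t / c. *)
Lemma powR_le_tangent (t c s : R) : 0 < t -> 0 < c -> 0 <= s <= 1 ->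
  t `^ s <= c `^ s * (1 - s + s * (t / c)).
Proof.
move=> t0 c0 /andP[s0 s1].
have tc : 0 < t / c by rewrite divr_gt0.
rewrite -{1}(divfK (lt0r_neq0 c0) t) powRM ?(ltW tc) ?(ltW c0)// mulrC.
rewrite ler_wpM2l ?powR_ge0//.
(* Both sides divided by y: apply ln u <= u - 1 to u = v / y and to u = 1 / y
   with the weights s and 1 - s; the two right-hand sides add up to 0. *)
set v := t / c in tc *; set y := 1 - s + s * v.
have y0 : 0 < y.
  have [sn1|sn1] := eqVneq s 1; first by rewrite /y sn1 subrr add0r mul1r.
  by rewrite /y ltr_pwDl// ?subr_gt0 ?lt_neqAle ?sn1// mulr_ge0 ?(ltW tc).
rewrite -(@lnK _ (v `^ s)) ?posrE ?powR_gt0// -(@lnK _ y) ?posrE// ler_expR ln_powR.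
have h1 := ler_wpM2l s0 (ln_le_sub1 _ (divr_gt0 tc y0)).
have h2 : (1 - s) * ln y^-1 <= (1 - s) * (y^-1 - 1).
  by rewrite ler_wpM2l ?subr_ge0// ln_le_sub1 ?invr_gt0.
rewrite ln_div ?posrE// in h1; rewrite lnV ?posrE// in h2.
have e : s * (v / y - 1) + (1 - s) * (y^-1 - 1) = 0.
  have yE : y = 1 - s + s * v by [].
  clearbody y v; rewrite -[X in _ = X](subrr 1) -{4}(divff (lt0r_neq0 y0)).
  by rewrite {3}yE; ring.
lra.
Qed.

(** Integrate the tangent bound at c = x against t^(x - 1) e^(-t). Under this
    weight t has mean x, by the functional equation, so the linear term of the
    tangent contributes nothing. *)
Lemma Gamma_shift_le x s : 0 < x -> 0 <= s <= 1 -> Gamma (x + s) <= x `^ s * Gamma x.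
Proof.
move=> x0 s01; have /andP[s0 s1] := s01.
have xs0 : 0 < x + s by rewrite ltr_wpDr.
have mp : measurable (positive_reals : set (measurableTypeR R))
  by exact: measurable_itv.
have mg y : measurable_fun (positive_reals : set (measurableTypeR R))
  (EFin \o gamma_fun y).
  by apply/measurable_EFinP; exact: measurable_gamma_fun.
have g0 y t : (0%R <= (gamma_fun y t)%:E)%E by rewrite lee_fin gamma_fun_ge0.
rewrite -lee_fin EFinM -!eGammaE//.
have e1 : ((x `^ s)%:E * eGamma x = (x `^ s * (1 - s))%:E * eGamma x +
  (x `^ s * s / x)%:E * eGamma (x + 1))%E.
  rewrite !eGammaE ?addr_gt0// GammaS// -!EFinM -EFinD; congr EFin.
  by field; rewrite gt_eqF.
have c1 : (0%R <= (x `^ s * (1 - s))%:E)%E by rewrite lee_fin mulr_ge0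
  ?powR_ge0// subr_ge0.
have c2 : (0%R <= (x `^ s * s / x)%:E)%E by rewrite lee_fin divr_ge0 ?mulr_ge0
  ?powR_ge0// ltW.
have mz c y : measurable_fun (positive_reals : set (measurableTypeR R)) (fun t =>
  c%:E * (gamma_fun y t)%:E)%E.
  by apply: measurable_funeM; exact: mg.
rewrite e1 /eGamma -!ge0_integralZl//; try exact: mg.
rewrite -ge0_integralD//; last first.
- by move=> t _; rewrite mule_ge0.
- by move=> t _; rewrite mule_ge0.
apply: ge0_le_integral => //.
- exact: mg.
- by apply: emeasurable_funD; exact: mz.
move=> t; rewrite /positive_reals/= in_itv/= andbT => t0.
rewrite -!EFinM -EFinD lee_fin /gamma_fun.
have -> : x + s - 1 = (x - 1) + s by ring.
rewrite powRD; last by rewrite (gt_eqF t0) implybT.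
have -> : t `^ (x + 1 - 1) = t `^ (x - 1) * t.
  by rewrite addrK [RHS]mulrC mulr_powRB1// ltW.
have := powR_le_tangent t x s t0 x0 s01 => h.
apply: (@le_trans _ _ (t `^ (x - 1) * expR (- t) * (x `^ s * (1 - s + s * (t / x))))).
  by rewrite mulrAC ler_wpM2l// mulr_ge0 ?powR_ge0 ?expR_ge0.
by rewrite le_eqVlt; apply/orP; left; apply/eqP; ring.
Qed.

Lemma Gamma_rising (z : R) (N : nat) : 0 < z ->
  Gamma (z + N%:R) = (\prod_(k < N) (z + k%:R)) * Gamma z.
Proof.
move=> z0; elim: N => [|N IH]; first by rewrite big_ord0 addr0 mul1r.
rewrite big_ord_recr/= -natr1 addrA GammaS ?IH; last by rewrite ltr_wpDr.
by rewrite mulrCA mulrA.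
Qed.

Lemma cvg_ratio_shift (z : R) : (1 + z / n.+1%:R) @[n --> \oo] --> (1 : R).
Proof.
rewrite -[X in _ --> X]addr0; apply: cvgD; first exact: cvg_cst.
by rewrite -[X in _ --> X](mulr0 z); apply: cvgMr; exact: cvg_harmonic.
Qed.

(** For z <= 1 the ratio lies between (1 + z / (n + 1))^(-1) and 1, by
    [Gamma_shift_le] with the increments 1 - z and z respectively; the
    functional equation carries the limit from z - 1 to z. *)
Lemma Gamma_asymptotic (z : R) : 0 <= z ->
  (Gamma (z + n.+1%:R) / (Gamma n.+1%:R * n.+1%:R `^ z)) @[n --> \oo] --> (1 : R).
Proof.
move=> z0; have [m zm] : exists m : nat, z <= m.+1%:R.
  exists (Num.truncn z); rewrite ltW//.
  exact: real_truncnS_gt (ger0_real z0).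
elim: m z z0 zm => [|m IH] z z0 zm.
  have q0 n : 0 < Gamma n.+1%:R * n.+1%:R `^ z.
    by rewrite mulr_gt0 ?powR_gt0 ?ltr0n// Gamma_gt0.
  apply: (@squeeze_cvgr _ _ _ _ (fun n => (1 + z / n.+1%:R)^-1) (fun=> 1)).
  - apply: nearW => n; apply/andP; split; last first.
      by rewrite ler_pdivrMr// mul1r addrC mulrC Gamma_shift_le// z0.
    rewrite ler_pdivlMr//.
    have nz0 : 0 < n.+1%:R + z by rewrite ltr_wpDr.
    have h : n.+1%:R * Gamma n.+1%:R <= (n.+1%:R + z) `^ (1 - z) *
      Gamma (z + n.+1%:R).
      rewrite -GammaS// [z + _]addrC.
      have -> : n.+1%:R + 1 = n.+1%:R + z + (1 - z) by ring.
      by apply: Gamma_shift_le => //; rewrite subr_ge0 zm gerBl.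
    rewrite -(ler_pM2l (powR_gt0 (1 - z) nz0)); apply: le_trans h.
    have -> : 1 + z / n.+1%:R = (n.+1%:R + z) / n.+1%:R by field.
    rewrite invf_div [leRHS]mulrC [leLHS](_ : _ =
      Gamma n.+1%:R * ((n.+1%:R + z) `^ (1 - z) * n.+1%:R `^ z *
        (n.+1%:R / (n.+1%:R + z)))); last by ring.
    rewrite ler_pM2l ?Gamma_gt0// mulrA ler_pdivrMr// [leRHS]mulrC ler_pM2r//.
    have e : n.+1%:R + z = (n.+1%:R + z) `^ (1 - z) * (n.+1%:R + z) `^ z.
      by rewrite -powRD ?subrK ?(gt_eqF nz0) ?implybT// powRr1// ltW.
    rewrite [leRHS]e.
    rewrite ler_pM2l ?powR_gt0//; apply: ge0_ler_powR => //; rewrite ?nnegrE ?ler0n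
      ?(ltW nz0)//.
    by rewrite lerDl.
  - rewrite -[X in _ --> X]invr1; apply: cvgV => //; exact: cvg_ratio_shift.
  - exact: cvg_cst.
have [z1|z1] := leP z 1; first by apply: IH => //; apply: le_trans z1 _;
  rewrite ler1n.
have zm1 : 0 < z - 1 by rewrite subr_gt0.
have -> : (fun n => Gamma (z + n.+1%:R) / (Gamma n.+1%:R * n.+1%:R `^ z)) =
  (fun n => Gamma (z - 1 + n.+1%:R) / (Gamma n.+1%:R * n.+1%:R `^ (z - 1)) *
    (1 + (z - 1) / n.+1%:R)).
  apply/funext => n.
  have -> : z + n.+1%:R = z - 1 + n.+1%:R + 1 by ring.
  rewrite GammaS; last by rewrite addr_gt0// ltr0n.
  rewrite -(mulr_powRB1 (ler0n R n.+1) (lt_trans ltr01 z1)).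
  field; rewrite !gt_eqF ?powR_gt0 ?Gamma_gt0//.
rewrite -[X in _ --> X](mulr1 1); apply: cvgM; last exact: cvg_ratio_shift.
by apply: IH; [exact: ltW|rewrite lerBlDr natr1].
Qed.

Lemma Gamma1 : Gamma 1 = 1.
Proof.
rewrite /Gamma (_ : eGamma 1 = 1%E)//.
have := integral_expRN 0; rewrite oppr0 expR0 => <-.
rewrite -integral_itv_obnd_cbnd; last first.
  apply/measurable_EFinP/measurable_funTS.
  by apply: measurableT_comp => //; exact: measurableT_comp.
by apply: eq_integral => t _; rewrite /gamma_fun subrr powRr0 mul1r.
Qed.

Lemma Gamma_fact n : Gamma n.+1%:R = n`!%:R.
Proof.
elim: n => [|n IH]; first by rewrite Gamma1.
by rewrite -natr1 GammaS// IH -natrM -factS.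
Qed.

(** Euler's product: the rising factorial is Gamma(z + n + 1) / Gamma(z), and
    the asymptotics of the numerator are known. *)
Lemma rising_asymptotic (z : R) : 0 < z ->
  ((\prod_(k < n.+1) (z + k%:R)) / (n`!%:R * n.+1%:R `^ z)) @[n --> \oo] -->
    (Gamma z)^-1.
Proof.
move=> z0; have := Gamma_asymptotic _ (ltW z0).
rewrite -[X in _ -> _ --> X]mul1r => h.
have -> : (fun n => (\prod_(k < n.+1) (z + k%:R)) / (n`!%:R * n.+1%:R `^ z)) =
  (fun n => Gamma (z + n.+1%:R) / (Gamma n.+1%:R * n.+1%:R `^ z) * (Gamma z)^-1).
  apply/funext => n; rewrite Gamma_rising// Gamma_fact; field.
  by rewrite !gt_eqF ?powR_gt0 ?Gamma_gt0// ltr0n fact_gt0.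
by apply: cvgMl h.
Qed.

(** The factor e^z is uniform in n, and explicit in z; this matters since the
    bound is used at points z that grow with the summation index. Of the
    factors of the product, k = 0 gives z, k = 1 is at most e^z, and each
    later one is k times a number absorbed by the growth of k^z. *)
Lemma rising_le (z : R) n : 0 < z ->
  \prod_(k < n.+1) (z + k%:R) <= z * n`!%:R * (expR z * n.+1%:R `^ z).
Proof.
move=> z0.
(* 1 + z / k <= e^(z / k) <= (k / (k - 1))^z with k = m + 2, since
   ln (1 - 1 / k) <= -1 / k. *)
have step m : (1 + z / m.+2%:R) * m.+1%:R `^ z <= m.+2%:R `^ z :> R.
  rewrite -ler_pdivlMr ?powR_gt0//.
  apply: (le_trans (expR_ge1Dx _)).
  rewrite -[leRHS]lnK ?posrE ?divr_gt0 ?powR_gt0// ler_expR.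
  rewrite ln_div ?posrE ?powR_gt0// !ln_powR -mulrBr ler_pM2l//.
  rewrite -ln_div ?posrE// -[leRHS]opprK -lnV ?posrE ?divr_gt0// invf_div.
  rewrite lerNr; apply: le_trans (ln_le_sub1 _ _) _; first by rewrite divr_gt0.
  have -> : (m.+1%:R : R) = m.+2%:R - 1 by rewrite -(natr1 m.+1) addrK.
  by rewrite mulrBl divff// mul1r addrAC subrr add0r.
(* The factor k = 1 being spent on e^z, induction gives the power of m + 1
   where the claim has m + 2. *)
have strong m : \prod_(k < m.+2) (z + k%:R) <=
  z * m.+1`!%:R * (expR z * m.+1%:R `^ z).
  elim: m => [|m IH].
    rewrite !big_ord_recr big_ord0/= powR1 mulr1 mul1r addr0 mulr1 ler_pM2l//.
    by rewrite addrC expR_ge1Dx.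
  rewrite big_ord_recr/=.
  apply: (@le_trans _ _ (z * m.+1`!%:R * (expR z * m.+1%:R `^ z) * (z + m.+2%:R))).
    by rewrite ler_wpM2r// addr_ge0// ltW.
  rewrite [m.+2`!]factS natrM.
  have -> : z + m.+2%:R = m.+2%:R * (1 + z / m.+2%:R) by field.
  have -> : z * m.+1`!%:R * (expR z * m.+1%:R `^ z) * (m.+2%:R * (1 + z / m.+2%:R))
     = (z * (m.+2%:R * m.+1`!%:R) * expR z) * ((1 + z / m.+2%:R) * m.+1%:R `^ z)
       by ring.
  by rewrite [leRHS]mulrA ler_wpM2l// !mulr_ge0// ?expR_ge0 ?ltW.
case: n => [|n].
  rewrite big_ord_recr big_ord0/= mul1r addr0 powR1 !mulr1 ler_peMr ?ltW//.
  by rewrite -expR0 ltr_expR.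
apply: le_trans (strong n) _.
rewrite ler_wpM2l ?mulr_ge0 ?(ltW z0)//.
rewrite ler_wpM2l ?expR_ge0//.
by rewrite ge0_ler_powR ?nnegrE ?ler_nat// ltW.
Qed.

End Gamma_function.

(** * Sums over pairs of permutations as determinants *)
Section biorthogonal_algebra.
Variable F : comNzRingType.

(** Composing with one fixed extension identifies the extensions of f with the
    permutations that move only the last m indices. *)
Lemma card_perm_extending (n m : nat) (f : {ffun 'I_n -> 'I_(n + m)}) :
  injective f ->
  #|[set s : 'S_(n + m) | [ffun k => s (lshift m k)] == f]%SET| = m`!.
Proof.
move=> injf.
have cA : #|~: (f @: [set: 'I_n]%SET)| = m.
  by rewrite cardsCs finset.setCK card_imset// cardsT !card_ord addKn.
pose g (k : 'I_(n + m)) := match fintype.split k with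
  | inl i => f i | inr j => enum_val (cast_ord (esym cA) j) end.
have gl i : g (lshift m i) = f i
  by rewrite /g -[lshift m i]/(unsplit (inl i)) unsplitK.
have gr j : g (rshift n j) = enum_val (cast_ord (esym cA) j).
  by rewrite /g -[rshift n j]/(unsplit (inr j)) unsplitK.
have grA j : g (rshift n j) \notin f @: [set: 'I_n]%SET.
  by rewrite gr -finset.in_setC; exact: enum_valP.
have injg : injective g.
  move=> x y; rewrite -[x]splitK -[y]splitK.
  case: (fintype.split x) => i; case: (fintype.split y) => j; rewrite /unsplit.
  - by rewrite !gl => /injf ->.
  - by rewrite gl => e; have := grA j; rewrite -e imset_f.
  - by rewrite gl => e; have := grA i; rewrite e imset_f.
  - by rewrite !gr => /enum_val_inj/cast_ord_inj ->.
pose B : {set 'I_(n + m)} := [set rshift n j | j : 'I_m]%SET.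
have cB : #|B| = m by rewrite card_imset ?card_ord//; exact: rshift_inj.
pose s0 := perm injg.
transitivity #|[set (p * s0)%g | p in perm_on B]%SET|; last first.
  by rewrite (card_imset _ (@mulIg _ s0)) card_perm cB.
apply: eq_card => s; rewrite !inE; apply/eqP/imsetP => [sf|[p pB ->]].
  exists (s * s0^-1)%g; last by rewrite mulgKV.
  rewrite unfold_in /perm_on; apply/fintype.subsetP => x; rewrite !inE permM;
    apply: contraNT => xB.
  have [i ->] : exists i, x = lshift m i.
    move: xB; rewrite -[x]splitK; case: (fintype.split x) => i /=; first by exists i.
    by rewrite imset_f.
  apply/eqP; apply: (@perm_inj _ s0); rewrite permKV permE gl.
  by rewrite -sf ffunE.
apply/ffunP => k; rewrite ffunE permM (out_perm pB) ?permE ?gl//.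
by apply/imsetP => -[j _ /eqP]; rewrite eq_lrshift.
Qed.

Lemma det_dup_col (n : nat) (A : 'M[F]_n) (i j : 'I_n) : i != j ->
  (forall k, A k i = A k j) -> \det A = 0.
Proof.
by move=> ij Aij; rewrite -det_tr; apply: (determinant_alternate ij) => k;
  rewrite !mxE.
Qed.

(** The Cauchy-Binet formula with the sum over all maps in place of increasing
    ones: expand the determinant and exchange sum and product. *)
Lemma sum_prod_det (n N : nat) (a b : 'I_n -> 'I_N -> F) :
  \sum_(f : {ffun 'I_n -> 'I_N})
     (\prod_k a k (f k)) * \det (\matrix_(i, j) b i (f j))
  = \det (\matrix_(i, j) \sum_l a i l * b j l).
Proof.
under eq_bigr => f _ do rewrite -det_tr /determinant big_distrr/=.
rewrite exchange_big/=; apply: eq_bigr => s _.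
under eq_bigr => f _ do rewrite mulrCA -big_split/=.
rewrite -big_distrr/=; congr (_ * _).
under [RHS]eq_bigr => i _ do rewrite mxE.
rewrite bigA_distr_bigA/=; apply: eq_bigr => f _.
by apply: eq_bigr => k _; rewrite !mxE.
Qed.

(** The left side is the Leibniz expansion of the determinant of b stacked on
    m rows of a permutation matrix; permuting the columns by s makes the
    lower right block the identity and the lower left block zero. *)
Lemma sum_det_agreeing (n m : nat) (b : 'I_n -> 'I_(n + m) -> F) (s : 'S_(n + m)) :
  \sum_(t : 'S_(n + m)) (-1) ^+ t * (\prod_k b k (t (lshift m k))) *
     (\prod_k (s (rshift n k) == t (rshift n k))%:R)
  = (-1) ^+ s * \det (\matrix_(i, j) b i (s (lshift m j))).
Proof.
pose M : 'M[F]_(n + m) := col_mx (\matrix_(i, l) b i l)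
  (\matrix_(i, l) (s (rshift n i) == l)%:R).
transitivity (\det M).
  apply: eq_bigr => t _; rewrite big_split_ord/= mulrA.
  congr (_ * _ * _); apply: eq_bigr => k _; first by rewrite col_mxEu mxE.
  by rewrite col_mxEd mxE.
have e : col_perm s M = block_mx (\matrix_(i, j) b i (s (lshift m j)))
    (\matrix_(i, j) b i (s (rshift n j))) 0 1%:M.
  apply/matrixP => i j; rewrite mxE -[i]splitK -[j]splitK.
  case: (fintype.split i) => i'; case: (fintype.split j) => j'; rewrite /unsplit.
  - by rewrite col_mxEu block_mxEul !mxE.
  - by rewrite col_mxEu block_mxEur !mxE.
  - by rewrite col_mxEd block_mxEdl !mxE (inj_eq perm_inj) eq_rlshift.
  - by rewrite col_mxEd block_mxEdr !mxE (inj_eq perm_inj) eq_rshift.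
have := congr1 determinant e; rewrite det_ublock det1 mulr1 => <-.
by rewrite col_permE det_mulmx det_perm odd_permV mulrCA -signr_addb addbb mulr1.
Qed.

(** This is what remains of the product of two Leibniz expansions once the
    last m variables are integrated out against a biorthogonal system: the
    Kronecker symbols force s and t to agree on the last m indices. The sum
    over t is a determinant depending on s only through its values on the
    first n indices; each injective choice of these values occurs for m!
    permutations, and for the others the determinant vanishes. *)
Lemma sum_perm_pairs_agreeing (n m : nat) (a b : 'I_n -> 'I_(n + m) -> F) :
  \sum_(s : 'S_(n + m)) \sum_(t : 'S_(n + m)) (-1) ^+ s * (-1) ^+ t *
     (\prod_k (a k (s (lshift m k)) * b k (t (lshift m k)))) *
     (\prod_k (s (rshift n k) == t (rshift n k))%:R)
  = m`!%:R * \det (\matrix_(i, j) \sum_l a i l * b j l).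
Proof.
pose G (f : {ffun 'I_n -> 'I_(n + m)}) :=
  (\prod_k a k (f k)) * \det (\matrix_(i, j) b i (f j)).
transitivity (\sum_(s : 'S_(n + m)) G [ffun k => s (lshift m k)]).
  apply: eq_bigr => s _.
  transitivity ((-1) ^+ s * (\prod_k a k (s (lshift m k))) *
     ((-1) ^+ s * \det (\matrix_(i, j) b i (s (lshift m j))))).
    rewrite -sum_det_agreeing big_distrr/=; apply: eq_bigr => t _.
    have assoc (u v A B C : F) : u * v * (A * B) * C = u * A * (v * B * C) by ring.
    by rewrite big_split/=; exact: assoc.
  rewrite mulrACA -signr_addb addbb mul1r /G.
  congr (_ * _); first by apply: eq_bigr => k _; rewrite ffunE.
  by congr determinant; apply/matrixP => i j; rewrite !mxE ffunE.
rewrite (partition_big (fun s : 'S_(n + m) => [ffun k => s (lshift m k)]) xpredT)//=.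
rewrite -sum_prod_det big_distrr/=; apply: eq_bigr => f _.
rewrite (eq_bigr (fun=> G f)); last by move=> s /eqP ->.
rewrite sumr_const mulr_natl.
have [/injectiveP injf|/injectivePn[i [j ij fij]]] := boolP (injectiveb f).
  rewrite -(card_perm_extending _ _ _ injf).
  by congr (_ *+ _); apply: eq_card => s; rewrite inE.
rewrite /G (det_dup_col _ _ i j ij) ?mulr0 ?mul0rn//.
by move=> k; rewrite !mxE fij.
Qed.

End biorthogonal_algebra.

(** * Integrals of products over tuples *)
Section tuple_integrals.
Variable R : realType.
Notation mu := (@lebesgue_measure R).
Notation RR := (measurableTypeR R).
Local Open Scope ereal_scope.

Lemma tnth_tuple_cons0 m (p : RR * m.-tuple RR) : tnth (tuple_cons p) ord0 = p.1.
Proof. by []. Qed.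

Lemma tnth_tuple_consS m (p : RR * m.-tuple RR) i :
  tnth (tuple_cons p) (lift ord0 i) = tnth p.2 i.
Proof. by rewrite !(tnth_nth p.1). Qed.

Lemma ge0_integral_lebesgue_tupleS m (G : m.+1.-tuple RR -> \bar R) :
  measurable_fun setT G -> (forall x, 0 <= G x) ->
  \int[lebesgue_tuple R m.+1]_x G x
  = \int[mu]_t \int[lebesgue_tuple R m]_y G (tuple_cons (t, y)).
Proof.
move=> mG G0.
transitivity (\int[(mu \x lebesgue_tuple R m)]_p G (tuple_cons p)).
  have := @ge0_integral_pushforward _ _ _ _ R _ (@measurable_tuple_cons _ RR m)
    (mu \x lebesgue_tuple R m) setT G measurableT mG (fun _ _ => G0 _).
  by rewrite preimage_setT.
rewrite fubini_tonelli1//; apply: measurableT_comp => //.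
exact: measurable_tuple_cons.
Qed.

(** Fubini's theorem for a product f(x_0) g(x_1, ..., x_m). Integrability is
    part of the conclusion since the induction on the number of factors
    needs it. *)
Lemma integral_lebesgue_tupleS_mul m (f : RR -> R) (g : m.-tuple RR -> R) :
  mu.-integrable setT (EFin \o f) ->
  (lebesgue_tuple R m).-integrable setT (EFin \o g) ->
  let h (x : m.+1.-tuple RR) := (f (tnth x ord0) * g [tuple of behead x])%R in
  (lebesgue_tuple R m.+1).-integrable setT (EFin \o h) /\
  \int[lebesgue_tuple R m.+1]_x (h x)%:E =
    \int[mu]_t (f t)%:E * \int[lebesgue_tuple R m]_y (g y)%:E.
Proof.
move=> intf intg h.
have mf : measurable_fun setT f by apply/measurable_EFinP; case/integrableP : intf.
have mg : measurable_fun setT g by apply/measurable_EFinP; case/integrableP : intg.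
have mh : measurable_fun setT (EFin \o h).
  apply/measurable_EFinP/measurable_funM.
    by apply: measurableT_comp => //; exact: measurable_tnth.
  by apply: measurableT_comp => //; exact: measurable_behead.
have hE t y : h (tuple_cons (t, y)) = (f t * g y)%R.
  rewrite /h tnth_tuple_cons0/=; congr (_ * g _)%R; exact/val_inj.
have mhc : measurable_fun setT (EFin \o h \o @tuple_cons _ RR m).
  by apply: measurableT_comp => //; exact: measurable_tuple_cons.
have intg' : \int[lebesgue_tuple R m]_y (g y)%:E \is a fin_num
  by exact: integrable_fin_num.
have ih : (mu \x lebesgue_tuple R m).-integrable setT
  (EFin \o h \o @tuple_cons _ RR m).
  apply/(integrable12ltyP mu (lebesgue_tuple R m) mhc).
  have {}intg := integrable_abse intg.
  have {}intf := integrable_abse intf.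
  rewrite (_ : (fun x => _) = (fun t : RR => `|(f t)%:E| * \int[lebesgue_tuple R m]_y
    `|(g y)%:E|)); last first.
    apply/funext => t; rewrite -ge0_integralZl//; last first.
      by do 2 apply: measurableT_comp => //.
    by apply: eq_integral => y _; rewrite /= hE normrM EFinM.
  have cf : \int[lebesgue_tuple R m]_y `|(g y)%:E| \is a fin_num
    by exact: integrable_fin_num.
  have := integrableZr measurableT (fine (\int[lebesgue_tuple R m]_y `|(g y)%:E|))
    intf.
  rewrite fineK// => /integrableP[_]; apply: le_lt_trans.
  rewrite [leRHS](eq_integral (fun t : RR => `|(f t)%:E| * \int[lebesgue_tuple R m]_y
    `|(g y)%:E|))//.
  move=> t _; rewrite gee0_abs//; apply: mule_ge0; first exact: abse_ge0.
  by apply: integral_ge0 => y _; exact: abse_ge0.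
split.
  exact: (integrable_pushforward (@measurable_tuple_cons _ RR m) mh ih measurableT).
transitivity (\int[mu \x lebesgue_tuple R m]_p (EFin \o h \o @tuple_cons _ RR m) p).
  have := integral_pushforward (@measurable_tuple_cons _ RR m) mh ih measurableT.
  by rewrite preimage_setT.
rewrite -integral12_prod_meas1//.
transitivity (\int[mu]_t ((f t)%:E * \int[lebesgue_tuple R m]_y (g y)%:E)).
  apply: eq_integral => t _; rewrite /fubini_F -integralZl//.
  by apply: eq_integral => y _; rewrite /= hE EFinM.
by rewrite -(fineK intg') integralZr.
Qed.

Lemma integrable_lebesgue_tuple_prod m (f : 'I_m -> RR -> R) :
  (forall i, mu.-integrable setT (EFin \o f i)) ->
  (lebesgue_tuple R m).-integrable setT
    (EFin \o (fun x => \prod_i f i (tnth x i))%R) /\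
  \int[lebesgue_tuple R m]_x (\prod_i f i (tnth x i))%:E =
    (\prod_i \int[mu]_t f i t)%:E.
Proof.
elim: m f => [|m IH] f intf.
  have e : \int[lebesgue_tuple R 0]_x 1%:E = 1%:E.
    by rewrite integral_dirac// diracT mul1e.
  split; last by rewrite big_ord0 -e; apply: eq_integral => x _; rewrite big_ord0.
  apply/integrableP; split.
    by apply/measurable_EFinP; apply: measurable_prod => -[].
  apply: (@le_lt_trans _ _ 1); last exact: ltry.
  by rewrite -e le_eqVlt; apply/orP; left; apply/eqP; apply: eq_integral => x _;
    rewrite /= big_ord0 normr1.
have [int1 e1] := IH (fun i => f (lift ord0 i)) (fun i => intf _).
have [ih eh] := integral_lebesgue_tupleS_mul m (f ord0) _ (intf ord0) int1.
set H := (fun x => \prod_i f i (tnth x i))%R.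
rewrite (_ : \int[_]_x _ = \int[lebesgue_tuple R m.+1]_x (H x)%:E)//.
have -> : H = (fun x : m.+1.-tuple RR => f ord0 (tnth x ord0) *
    \prod_i f (lift ord0 i) (tnth [tuple of behead x] i))%R.
  apply/funext => x; rewrite /H big_ord_recl; congr (_ * _)%R.
  apply: eq_bigr => i _; rewrite tnth_behead; congr (f _ (tnth _ _)).
  by apply/val_inj; rewrite /= inordK// ltnS.
split => //; rewrite eh e1 big_ord_recl EFinM; congr (_ * _).
by rewrite /Rintegral fineK//; exact: (integrable_fin_num _ (intf ord0)).
Qed.

End tuple_integrals.

(** * Correlation functions of biorthogonal ensembles *)
Section finite_combinations_of_integrals.
Context d (T : measurableType d) (R : realType) (m : {measure set T -> \bar R}).

(** The integral is additive only on integrable functions, so both facts travel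
    together. *)
Definition has_integral (f : T -> R) (v : R) :=
  m.-integrable setT (EFin \o f) /\ \int[m]_x f x = v.

Lemma has_integral0 : has_integral (fun=> 0) 0.
Proof.
split; first exact: integrable0.
by rewrite /Rintegral integral0.
Qed.

Lemma has_integralD f g u v : has_integral f u -> has_integral g v ->
  has_integral (fun x => f x + g x) (u + v).
Proof.
move=> [fi fe] [gi ge]; split; first exact: (integrableD measurableT fi gi).
by rewrite RintegralD// fe ge.
Qed.

Lemma has_integralZ c f u : has_integral f u ->
  has_integral (fun x => c * f x) (c * u).
Proof.
move=> [fi fe]; split; first exact: (integrableZl measurableT c fi).
by rewrite RintegralZl// fe.
Qed.

Lemma has_integral_sum (I : Type) (r : seq I) (P : pred I) (f : I -> T -> R)
  (u : I -> R) :
  (forall i, has_integral (f i) (u i)) ->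
  has_integral (fun x => \sum_(i <- r | P i) f i x) (\sum_(i <- r | P i) u i).
Proof.
move=> fu; elim: r => [|i r IH].
  rewrite big_nil; under eq_fun do rewrite big_nil; exact: has_integral0.
rewrite big_cons; under eq_fun do rewrite big_cons.
by case: ifP => // _; exact: has_integralD.
Qed.

End finite_combinations_of_integrals.
Arguments has_integral {d T R}.

Section biorthogonal_ensemble.
Variable R : realType.
Notation mu := (@lebesgue_measure R).
Notation RR := (measurableTypeR R).

Lemma prod_restrict_orthant m (h : 'I_m -> R -> R) (y : m.-tuple RR) :
  \prod_k ((h k) \_ (positive_reals R)) (tnth y k) =
  ((fun y : m.-tuple RR => \prod_k h k (tnth y k)) \_ (orthant R m)) y.
Proof.
rewrite [RHS]patchE; case: ifPn => [|].
  rewrite inE /orthant/= => y0; apply: eq_bigr => k _.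
  by rewrite patchE mem_set// /positive_reals/= in_itv/= y0.
rewrite notin_setE => /existsNP[k /negP yk].
rewrite (bigD1 k)//= patchE memNset ?mul0r// /positive_reals/= in_itv/= andbT.
exact/negP.
Qed.

(** Expand both determinants over permutations s and t. The integral of each
    term factors over the coordinates of y, and biorthogonality turns the k-th
    factor into a Kronecker symbol of s and t at the index n + k. *)
Lemma biorthogonal_marginal n m (phi psi : 'I_(n + m) -> R -> R) (w : R -> R) :
  (forall i j, has_integral mu
     ((fun x => phi i x * psi j x * w x) \_ (positive_reals R)) (i == j)%:R) ->
  forall x : n.-tuple R,
  has_integral (lebesgue_tuple R m)
    ((fun y : m.-tuple RR =>
      \det (\matrix_(k, i) phi i (tnth [tuple of x ++ y] k)) *
      \det (\matrix_(k, i) psi i (tnth [tuple of x ++ y] k)) *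
      \prod_k w (tnth [tuple of x ++ y] k)) \_ (orthant R m))
  (m`!%:R * \det (\matrix_(i, j) \sum_l phi l (tnth x i) * psi l (tnth x j)) *
    \prod_k w (tnth x k)).
Proof.
move=> ipp x.
pose h (s t : 'S_(n + m)) k (u : R) :=
  phi (s (rshift n k)) u * psi (t (rshift n k)) u * w u.
pose c (s t : 'S_(n + m)) := (-1) ^+ s * (-1) ^+ t *
  \prod_(k < n) (phi (s (lshift m k)) (tnth x k) * psi (t (lshift m k)) (tnth x k)).
have key : has_integral (lebesgue_tuple R m)
   (fun y => \sum_(s : 'S_(n + m)) \sum_(t : 'S_(n + m))
      (\prod_(k < n) w (tnth x k) * c s t) * \prod_k ((h s t k) \_ (positive_reals R))
        (tnth y k))
   (\sum_(s : 'S_(n + m)) \sum_(t : 'S_(n + m))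
      (\prod_(k < n) w (tnth x k) * c s t) *
      \prod_(k < m) (s (rshift n k) == t (rshift n k))%:R).
  apply: has_integral_sum => s; apply: has_integral_sum => t; apply: has_integralZ.
  have [i1 i2] := integrable_lebesgue_tuple_prod R m (fun k =>
    (h s t k) \_ (positive_reals R))
    (fun k => (ipp _ _).1).
  split => //.
  rewrite /Rintegral i2/=; apply: eq_bigr => k _.
  exact: (ipp _ _).2.
congr has_integral : key; last first.
  rewrite -[X in X * _](sum_perm_pairs_agreeing _ _ _ (fun i l => phi l (tnth x i))
    (fun i l => psi l (tnth x i))).
  rewrite big_distrl/=; apply: eq_bigr => s _.
  rewrite big_distrl/=; apply: eq_bigr => t _.
  by rewrite -mulrA [LHS]mulrC.
apply/funext => y.
under eq_bigr => s _ do under eq_bigr => t _ do rewrite prod_restrict_orthant.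
rewrite [RHS]patchE; case: ifPn => yo; last first.
  rewrite big1// => s _; rewrite big1// => t _.
  by rewrite patchE (negbTE yo) mulr0.
rewrite /determinant big_distrlr/= big_distrl/=; apply: eq_bigr => s _.
rewrite big_distrl/=; apply: eq_bigr => t _.
rewrite patchE yo /c !big_split_ord/=.
have assoc (a b A1 A2 B1 B2 C1 C2 : R) : a * (A1 * A2) * (b * (B1 * B2)) * (C1 * C2)
    = C1 * (a * b * (A1 * B1)) * (A2 * B2 * C2) by ring.
rewrite assoc; congr (_ * (_ * _) * _).
- by apply: eq_bigr => k _; rewrite tnth_lshift.
- by rewrite -big_split; apply: eq_bigr => k _; rewrite !mxE !tnth_lshift.
- by rewrite -!big_split; apply: eq_bigr => k _; rewrite !mxE !tnth_rshift.
Qed.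

Lemma RintegralZl_restrict d (T : measurableType d) (m : {measure set T -> \bar R})
    (D : set T) (f : T -> R) v c :
  has_integral m (f \_ D) v -> \int[m]_(x in D) (c * f x) = c * v.
Proof.
move=> fv; have [_ <-] := has_integralZ _ _ _ _ c _ _ fv.
rewrite Rintegral_mkcond; apply: eq_Rintegral => x _.
by rewrite /= !patchE; case: ifP; rewrite ?mulr0.
Qed.

End biorthogonal_ensemble.

(** * Newton series of polynomials *)
Section Newton_interpolation.
Variable R : numFieldType.

Lemma coef_Xsub1_exp i r :
  (('X - 1 : {poly R}) ^+ i)`_r = (-1) ^+ (i + r) * 'C(i, r)%:R.
Proof.
elim: i r => [|i IH] r.
  by rewrite expr0 coef1; case: r => [|r]; rewrite ?bin0 ?bin_small ?mulr1 ?mulr0.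
rewrite exprS mulrBl mul1r coefB coefXM !IH; case: r => [|r] /=.
  by rewrite !bin0 !mulr1 sub0r !addn0 exprS mulN1r.
rewrite binS natrD addSnnS !addnS !exprS; ring.
Qed.

Lemma sum_ord_widen_bin N i (g : nat -> R) : (i < N)%N ->
  \sum_(r < i.+1) 'C(i, r)%:R * g r = \sum_(r < N) 'C(i, r)%:R * g r.
Proof.
move=> iN; rewrite (big_ord_widen N (fun r => 'C(i, r)%:R * g r))// big_mkcond/=.
by apply: eq_bigr => r _; case: ltnP => // ir; rewrite bin_small ?mul0r.
Qed.

(** Expand X^m = (1 + (X - 1))^m in powers of X - 1, and each of these in powers
    of X; then apply the linear form sending X^r to f(r). *)
Lemma binomial_inversion N m (f : nat -> R) : (m < N)%N ->
  \sum_(i < N) 'C(m, i)%:R *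
     ((-1) ^+ i * \sum_(r < i.+1) 'C(i, r)%:R * ((-1) ^+ r * f r)) = f m.
Proof.
move=> mN; transitivity (\sum_(r < N) (('X : {poly R}) ^+ m)`_r * f r); last first.
  rewrite (bigD1 (Ordinal mN))//= coefXn eqxx mul1r big1 ?addr0// => r rm.
  rewrite coefXn (_ : (r == m :> nat) = false) ?mul0r//.
  by apply: contraNF rm => /eqP e; apply/eqP/val_inj.
have -> : 'X ^+ m = \sum_(i < N) ('X - 1 : {poly R}) ^+ i *+ 'C(m, i).
  transitivity (\sum_(i < m.+1) ('X - 1 : {poly R}) ^+ i *+ 'C(m, i)).
    rewrite -{1}(subrK 1 'X) addrC exprDn.
    by apply: eq_bigr => i _; rewrite expr1n mul1r.
  rewrite (big_ord_widen N (fun i => ('X - 1 : {poly R}) ^+ i *+ 'C(m, i)))//.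
  rewrite big_mkcond/=; apply: eq_bigr => i _.
  by case: ltnP => // mi; rewrite bin_small.
under [RHS]eq_bigr do rewrite coef_sum big_distrl/=.
rewrite exchange_big/=; apply: eq_bigr => i _.
rewrite (sum_ord_widen_bin N i (fun r => (-1) ^+ r * f r))// !big_distrr/=;
  apply: eq_bigr => r _.
rewrite coefMn coef_Xsub1_exp -mulr_natl exprD; ring.
Qed.

Definition falling_poly i : {poly R} := \prod_(k < i) ('X - (k%:R)%:P).

Lemma size_falling_poly i : size (falling_poly i) = i.+1.
Proof. by rewrite size_prod_XsubC -[index_enum _]enumT size_enum_ord. Qed.

Lemma falling_poly_nat i m : (falling_poly i).[m%:R] = (m ^_ i)%:R.
Proof.
rewrite /falling_poly horner_prod ffact_prod natr_prod.
have [im|mi] := leqP i m.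
  by apply: eq_bigr => k _; rewrite hornerXsubC natrB// ltnW//
    (leq_trans (ltn_ord k)).
rewrite (bigD1 (Ordinal mi))//= hornerXsubC subrr mul0r.
by rewrite (bigD1 (Ordinal mi))//= subnn mul0r.
Qed.

Lemma falling_poly_opp i s : (falling_poly i).[- s] =
  (-1) ^+ i * \prod_(k < i) (s + k%:R).
Proof.
rewrite /falling_poly horner_prod -[i in (-1) ^+ i]card_ord -prodrN.
by apply: eq_bigr => k _; rewrite hornerXsubC opprD.
Qed.

(** A polynomial of degree < N agrees with its Newton interpolation at
    0, ..., N - 1. The basis consists of the falling factorials, whose values
    at -s are, up to sign, the rising factorials of s. *)
Lemma Newton_series N (p : {poly R}) (s : R) : (size p <= N)%N ->
  \sum_(i < N) (\prod_(k < i) (s + k%:R)) / i`!%:R *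
     (\sum_(r < i.+1) 'C(i, r)%:R * ((-1) ^+ r * p.[r%:R])) = p.[- s].
Proof.
move=> sp.
pose c i := (-1) ^+ i * \sum_(r < i.+1) 'C(i, r)%:R * ((-1) ^+ r * p.[r%:R]).
pose q := \sum_(i < N) (c i / i`!%:R) *: falling_poly i.
have sq : (size q <= N)%N.
  apply: (leq_trans (size_sum _ _ _)); apply/bigmax_leqP => i _.
  by apply: (leq_trans (size_scale_leq _ _)); rewrite size_falling_poly.
have qm m : (m < N)%N -> q.[m%:R] = p.[m%:R].
  move=> mN; rewrite -[RHS](binomial_inversion N m (fun r => p.[r%:R]))// horner_sum.
  apply: eq_bigr => i _; rewrite hornerZ falling_poly_nat -bin_ffact natrM -/(c i).
  by field; rewrite pnatr_eq0 -lt0n fact_gt0.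
have pq : p = q.
  apply/eqP; rewrite -subr_eq0; apply/eqP.
  apply: (@roots_geq_poly_eq0 _ _ [seq m%:R | m <- iota 0 N]).
  - apply/allP => x /mapP[m]; rewrite mem_iota add0n => /andP[_ mN] ->.
    by rewrite rootE hornerD hornerN qm// subrr.
  - rewrite map_inj_uniq ?iota_uniq// => x y /eqP; rewrite eqr_nat => /eqP; exact.
  - rewrite size_map size_iota (leq_trans (size_polyD _ _))// geq_max sp.
    by rewrite size_polyN.
rewrite [in RHS]pq horner_sum; apply: eq_bigr => i _.
rewrite hornerZ falling_poly_opp /c.
have assoc (A B D e : R) : e * e = 1 -> A * D * B = e * B * D * (e * A).
  move=> ee; have -> : e * B * D * (e * A) = (e * e) * (A * D * B) by ring.
  by rewrite ee mul1r.
by apply: assoc; rewrite -expr2 sqrr_sign.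
Qed.

End Newton_interpolation.

(** * The inverse of the Gram matrix *)
Section Gram_inverse.
Variable R : realType.
Variables (a theta : R).
Hypotheses (a0 : 0 < a) (theta0 : 0 < theta).

Definition node (i : nat) : R := (i%:R + a) / theta.

Lemma node_gt0 i : 0 < node i.
Proof. by rewrite divr_gt0// ltr_wpDl. Qed.

Definition dual_node (j : nat) : R := theta * j%:R + a.

Lemma dual_node_gt0 j : 0 < dual_node j.
Proof. by rewrite ltr_wpDl// mulr_ge0// ltW. Qed.

(** A multiple of the Lagrange basis polynomial of the points 0, -1, ...,
    -(N - 1) that belongs to -j; its value at -j is (-1)^j j!. *)
Definition punctured_rising N (j : 'I_N) (z : R) : R :=
  (\prod_(k < N | k != j) (z + k%:R)) / (N - j.+1)`!%:R.

(** Up to sign, the i-th forward difference at 0 of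
    r |-> [punctured_rising N j (node r)]. *)
Definition node_difference N i (j : 'I_N) : R :=
  \sum_(r < i.+1) 'C(i, r)%:R * ((-1) ^+ r * punctured_rising N j (node r)).

Definition inverse_Gram N (i j : 'I_N) : R :=
  (-1) ^+ j / (i`!%:R * j`!%:R * Gamma R (dual_node j)) * node_difference N i j.

Lemma punctured_rising_integer N (j j' : 'I_N) :
  punctured_rising N j (- j'%:R) = (j == j')%:R * ((-1) ^+ j * j`!%:R).
Proof.
rewrite /punctured_rising; have [<-|jj'] := eqVneq j j'; last first.
  by rewrite (bigD1 j') 1?eq_sym//= addNr !mul0r.
rewrite mul1r.
have -> : \prod_(k < N | k != j) (- j%:R + k%:R) = (-1) ^+ j * j`!%:R *
  (N - j.+1)`!%:R :> R.
  transitivity (\prod_(0 <= k < N | k != j) (- j%:R + k%:R) : R).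
    by rewrite big_mkord.
  rewrite (big_cat_nat (n := j))//=; last exact: ltnW.
  rewrite [X in _ * X]big_ltn_cond//= eqxx/=.
  congr (_ * _).
    rewrite big_nat_cond (eq_bigl (fun k => (0 <= k < j)%N)); last first.
      by move=> k /=; case: ltngtP; rewrite ?andbF.
    rewrite -big_nat big_mkord.
    have := falling_poly_nat R j j; rewrite ffactnn => <-.
    rewrite /falling_poly horner_prod -[j in (-1) ^+ j]card_ord -prodrN.
    by apply: eq_bigr => k _; rewrite hornerXsubC opprB addrC.
  rewrite big_nat_cond (eq_bigl (fun k => (j.+1 <= k < N)%N)); last first.
    by move=> k /=; apply: andb_idr => /andP[jk _]; rewrite gtn_eqF.
  rewrite -big_nat -{1}[j.+1]add0n big_addn big_mkord fact_prod natr_prod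
    big_add1/= big_mkord.
  by apply: eq_bigr => k _; rewrite addnS -addSn natrD addrCA addNr addr0.
by rewrite mulfK// pnatr_eq0 -lt0n fact_gt0.
Qed.

(** The Gram entry at (i, j') is Gamma(s) times the rising factorial of length i
    of s = [dual_node j']. The sum is therefore the Newton series at -s of the
    polynomial x |-> [punctured_rising N j ((x + a) / theta)]. The argument
    (a - s) / theta equals -j', where only j = j' gives a non-zero value. *)
Lemma inverse_GramP N (j j' : 'I_N) :
  \sum_(i < N) inverse_Gram N i j * Gamma R (a + i%:R + theta * j'%:R) = (j == j')%:R.
Proof.
pose s := dual_node j'.
pose p : {poly R} := ((N - j.+1)`!%:R)^-1 *:
  \prod_(k < N | k != j) (theta^-1 *: 'X + (a / theta + k%:R)%:P).
have pE x : p.[x] = punctured_rising N j ((x + a) / theta).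
  rewrite /p hornerZ horner_prod mulrC; congr (_ / _); apply: eq_bigr => k _.
  by rewrite hornerD hornerZ hornerX hornerC; ring.
have sp : (size p <= N)%N.
  apply: (leq_trans (size_scale_leq _ _)); apply: (leq_trans (size_prod_leq _ _)).
  have cj : #|[pred k : 'I_N | k != j]| = N.-1 by rewrite cardC1 card_ord.
  rewrite leq_subLR.
  apply: (@leq_ltn_trans (\sum_(k < N | k != j) 2)%N).
    apply: leq_sum => k _; apply: (leq_trans (size_polyD _ _)).
    rewrite geq_max (leq_trans (size_scale_leq _ _)) ?size_polyX//.
    by rewrite (leq_trans (size_polyC_leq1 _)).
  by rewrite sum_nat_const cj muln2 -addnn ltn_add2l ltn_predL
    (leq_ltn_trans _ (ltn_ord j)).
have := Newton_series _ N p s sp.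
have -> : p.[- s] = (j == j')%:R * ((-1) ^+ j * j`!%:R).
  by rewrite pE -punctured_rising_integer; congr (punctured_rising _ _ _);
    rewrite /s /dual_node; field; rewrite gt_eqF.
move=> e.
transitivity ((-1) ^+ j / j`!%:R * (Gamma R s / Gamma R (dual_node j)) *
  ((j == j')%:R * ((-1) ^+ j * j`!%:R))).
  rewrite -e big_distrr/=; apply: eq_bigr => i _.
  have -> : a + i%:R + theta * j'%:R = s + i%:R by rewrite /s /dual_node; ring.
  rewrite Gamma_rising; last exact: dual_node_gt0.
  rewrite /inverse_Gram /node_difference.
  have -> : \sum_(r < i.+1) 'C(i, r)%:R * ((-1) ^+ r * p.[r%:R]) =
    \sum_(r < i.+1) 'C(i, r)%:R * ((-1) ^+ r * punctured_rising N j (node r)).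
    by apply: eq_bigr => r _; rewrite pE.
  field.
  by rewrite !pnatr_eq0 -!lt0n !fact_gt0 gt_eqF// Gamma_gt0// dual_node_gt0.
have [jj|_] := eqVneq j j'; last by rewrite mul0r mulr0.
rewrite /s -jj divff ?gt_eqF ?Gamma_gt0 ?dual_node_gt0// mulr1 mul1r.
have -> : (-1) ^+ j / j`!%:R * ((-1) ^+ j * j`!%:R) = ((-1) ^+ j) ^+ 2 *
  (j`!%:R / j`!%:R) :> R.
  by rewrite expr2; ring.
by rewrite sqrr_sign mul1r divff// pnatr_eq0 -lt0n fact_gt0.
Qed.

End Gram_inverse.

(** * Correlation functions of the finite Laguerre ensemble *)
Section Laguerre_correlation.
Variable R : realType.
Variables (alpha theta : R).
Hypotheses (alpha_gtN1 : -1 < alpha) (theta_gt0 : 0 < theta).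
Notation mu := (@lebesgue_measure R).
Notation RR := (measurableTypeR R).

Let a := alpha + 1.
Let a_gt0 : 0 < a. Proof. by rewrite -ltrBlDr sub0r. Qed.

Definition Laguerre_weight (x : R) : R := x `^ alpha * expR (- x).
Definition theta_monomial (l : nat) (x : R) : R := (x `^ theta) ^+ l.
Definition dual_poly N (l : 'I_N) (x : R) : R :=
  \sum_(i < N) inverse_Gram R a theta N i l * x ^+ i.
Definition Laguerre_kernel N (x y : R) : R :=
  \sum_(l < N) dual_poly N l x * theta_monomial l y.

(** The moments are Gamma integrals: this is why the Gram matrix is explicit. *)
Lemma monomial_gamma_fun i l (x : R) : 0 < x ->
  x ^+ i * theta_monomial l x * Laguerre_weight x =
    gamma_fun R (a + i%:R + theta * l%:R) x.
Proof.
move=> x0; rewrite /theta_monomial /Laguerre_weight /gamma_fun mulrA; congr (_ * _).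
rewrite -powR_mulrn ?(ltW x0)// -powR_mulrn ?powR_ge0// -powRrM.
rewrite -!powRD ?(gt_eqF x0) ?implybT//; congr (_ `^ _); rewrite /a; ring.
Qed.

Lemma integrable_gamma_fun (s : R) : 0 < s ->
  mu.-integrable (positive_reals R) (EFin \o gamma_fun R s).
Proof.
move=> s0; apply/integrableP; split.
  by apply/measurable_EFinP; exact: measurable_gamma_fun.
under eq_integral do rewrite /= ger0_norm ?gamma_fun_ge0//.
exact: eGamma_lty.
Qed.

Lemma Gram_index_gt0 i l : 0 < a + i%:R + theta * l%:R.
Proof.
apply: ltr_wpDr; first by rewrite mulr_ge0// ltW.
exact: ltr_wpDr.
Qed.

Lemma has_integral_Gram i l :
  has_integral mu
    ((fun x => x ^+ i * theta_monomial l x * Laguerre_weight x) \_ (positive_reals R))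
    (Gamma R (a + i%:R + theta * l%:R)).
Proof.
have -> : ((fun x => x ^+ i * theta_monomial l x * Laguerre_weight x) \_
  (positive_reals R)) =
   (gamma_fun R (a + i%:R + theta * l%:R)) \_ (positive_reals R).
  apply/funext => x; rewrite !patchE; case: ifPn => //.
  by rewrite inE /positive_reals/= in_itv/= andbT => x0; rewrite monomial_gamma_fun.
split; last by rewrite -Rintegral_mkcond.
rewrite -restrict_EFin; apply/integrable_restrict => //; first exact: measurable_itv.
by rewrite setTI; apply: integrable_gamma_fun; exact: Gram_index_gt0.
Qed.

Lemma has_integral_biorthogonal N (l j : 'I_N) :
  has_integral mu
    ((fun x => dual_poly N l x * theta_monomial j x * Laguerre_weight x) \_
       (positive_reals R)) (l == j)%:R.
Proof.
have -> : ((fun x => dual_poly N l x * theta_monomial j x * Laguerre_weight x) \_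
  (positive_reals R)) =
  (fun x => \sum_(i < N) inverse_Gram R a theta N i l *
     ((fun x => x ^+ i * theta_monomial j x * Laguerre_weight x) \_
       (positive_reals R)) x).
  apply/funext => x; rewrite patchE; case: ifPn => [xp|xp].
    rewrite /dual_poly 2!big_distrl/=; apply: eq_bigr => i _.
    by rewrite patchE xp -!mulrA.
  by rewrite big1// => i _; rewrite patchE (negbTE xp) mulr0.
rewrite -(inverse_GramP R a theta a_gt0 theta_gt0 N l j).
by apply: has_integral_sum => i; apply: has_integralZ; exact: has_integral_Gram.
Qed.

Lemma det_monomials N (z : 'I_N -> R) :
  \det (\matrix_(k, i) z k ^+ i) =
  \prod_(i < N) \prod_(j < N | (i < j)%N) (z j - z i).
Proof.
have -> : (\matrix_(k, i) z k ^+ i) = (Vandermonde N (\row_k z k))^T.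
  by apply/matrixP => k i; rewrite !mxE.
rewrite det_tr det_Vandermonde; apply: eq_bigr => i _; apply: eq_bigr => j _.
by rewrite !mxE.
Qed.

Definition inverse_Gram_det N : R :=
  \det (\matrix_(i, l) inverse_Gram R a theta N i l).

(** Needed to pass from the monomials to the dual polynomials inside a
    determinant. *)
Lemma inverse_Gram_det_neq0 N : inverse_Gram_det N != 0.
Proof.
pose G : 'M[R]_N := \matrix_(i, l) Gamma R (a + i%:R + theta * l%:R).
have : (\matrix_(i, l) inverse_Gram R a theta N i l)^T *m G = 1%:M.
  apply/matrixP => l j; rewrite !mxE -(inverse_GramP R a theta a_gt0 theta_gt0 N l j).
  by apply: eq_bigr => i _; rewrite !mxE.
move/(congr1 determinant); rewrite det_mulmx det_tr det1 => h.
by apply/eqP => h0; move: h; rewrite -/(inverse_Gram_det N) h0 mul0r => /esym/eqP;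
  rewrite oner_eq0.
Qed.

Definition biorthogonal_weight N (z : N.-tuple R) : R :=
  \det (\matrix_(k, i) dual_poly N i (tnth z k)) *
  \det (\matrix_(k < N, i < N) theta_monomial i (tnth z k)) *
  \prod_k Laguerre_weight (tnth z k).

(** Both products of differences are Vandermonde determinants; their signs
    cancel. *)
Lemma Lag_weightE N (z : N.-tuple R) :
  Lag_weight alpha theta z = (inverse_Gram_det N)^-1 * biorthogonal_weight N z.
Proof.
rewrite /biorthogonal_weight.
have -> : \matrix_(k, i) dual_poly N i (tnth z k) =
   (\matrix_(k, i) tnth z k ^+ i) *m (\matrix_(i, l) inverse_Gram R a theta N i l).
  apply/matrixP => k l; rewrite !mxE; apply: eq_bigr => i _.
  by rewrite !mxE mulrC.
rewrite det_mulmx -/(inverse_Gram_det N) !mulrA [_ * inverse_Gram_det N]mulrC mulVKf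
  ?inverse_Gram_det_neq0//.
rewrite !det_monomials -big_split/=.
rewrite /Lag_weight -mulrA; congr (_ * _).
  apply: eq_bigr => i _; rewrite -big_split/=; apply: eq_bigr => j _; ring.
by rewrite big_split/= -sumrN expR_sum.
Qed.

Lemma biorthogonal_weight_marginal n m (x : n.-tuple R) :
  has_integral (lebesgue_tuple R m)
    ((fun y : m.-tuple RR => biorthogonal_weight (n + m) [tuple of x ++ y]) \_
      (orthant R m))
    (m`!%:R * \det (\matrix_(i, j) Laguerre_kernel (n + m) (tnth x i) (tnth x j)) *
     \prod_k Laguerre_weight (tnth x k)).
Proof.
exact: (biorthogonal_marginal R n m (dual_poly (n + m)) (fun l => theta_monomial l)
  Laguerre_weight
  (has_integral_biorthogonal (n + m)) x).
Qed.

(** The marginal with no variable left. *)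
Lemma Lag_weight_integral N :
  \int[lebesgue_tuple R N]_(y in orthant R N) Lag_weight alpha theta y =
  (inverse_Gram_det N)^-1 * N`!%:R.
Proof.
under eq_Rintegral do rewrite Lag_weightE.
apply: RintegralZl_restrict.
have := biorthogonal_weight_marginal 0 N [tuple].
rewrite big_ord0 det_mx00 !mulr1.
congr has_integral; congr patch; apply/funext => y; congr biorthogonal_weight.
exact/val_inj.
Qed.

(** The constant relating the two weights cancels against the normalisation, and
    so do the factorials. *)
Lemma Lag_density_marginal n m (x : n.-tuple R) :
  (n + m)`!%:R / m`!%:R * \int[lebesgue_tuple R m]_(y in orthant R m)
    Lag_density alpha theta [tuple of x ++ y] =
  \det (\matrix_(i, j) Laguerre_kernel (n + m) (tnth x i) (tnth x j)) *
     \prod_k Laguerre_weight (tnth x k).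
Proof.
rewrite /Lag_density Lag_weight_integral.
under eq_Rintegral do rewrite Lag_weightE mulrA.
rewrite (RintegralZl_restrict _ _ _ _ _ _ _ _ (biorthogonal_weight_marginal n m x)).
have := inverse_Gram_det_neq0 (n + m) => D0.
have f0 k : k`!%:R != 0 :> R by rewrite pnatr_eq0 -lt0n fact_gt0.
move: (\det _) (\prod_k _) (inverse_Gram_det _) D0 (f0 m) (f0 (n + m)) => A B C.
move: (_`!%:R) (_`!%:R) => u v ? ? ?; field.
by apply/and3P.
Qed.

End Laguerre_correlation.

(** * Limits of finite and of dominated double sums *)
Section finite_limits.
Variable R : realType.

Lemma cvg_sumr (I : Type) (r : seq I) (P : pred I) (f : I -> R^nat) (l : I -> R) :
  (forall i, P i -> f i M @[M --> \oo] --> l i) ->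
  \sum_(i <- r | P i) f i M @[M --> \oo] --> \sum_(i <- r | P i) l i.
Proof. by move=> fl; apply: cvg_big => //; exact: add_continuous. Qed.

Lemma cvg_prodr (I : Type) (r : seq I) (P : pred I) (f : I -> R^nat) (l : I -> R) :
  (forall i, P i -> f i M @[M --> \oo] --> l i) ->
  \prod_(i <- r | P i) f i M @[M --> \oo] --> \prod_(i <- r | P i) l i.
Proof. by move=> fl; apply: cvg_big => //; exact: mul_continuous. Qed.

Lemma cvg_det n (A : nat -> 'I_n -> 'I_n -> R) (B : 'I_n -> 'I_n -> R) :
  (forall i j, A M i j @[M --> \oo] --> B i j) ->
  \det (\matrix_(i, j) A M i j) @[M --> \oo] --> \det (\matrix_(i, j) B i j).
Proof.
move=> AB; rewrite /determinant.
apply: cvg_sumr => s _; apply: cvgMr.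
have -> : \prod_i (\matrix_(i, j) B i j) i (s i) = \prod_i B i (s i).
  by apply: eq_bigr => i _; rewrite mxE.
have -> : (fun M => \prod_i (\matrix_(i, j) A M i j) i (s i)) =
  (fun M => \prod_i A M i (s i)).
  by apply/funext => M; apply: eq_bigr => i _; rewrite mxE.
by apply: cvg_prodr => i _; exact: AB.
Qed.

End finite_limits.

Section dominated_square_sums.
Variable R : realType.

(** Truncating on squares keeps the partial sums invariant under the exchange
    of the two indices, and matches the range of the kernel at finite N. *)
Definition square_sum (t : nat -> nat -> R) (M : nat) : R :=
  \sum_(i < M) \sum_(l < M) t i l.

Lemma square_sumS t M : square_sum t M.+1 - square_sum t M =
  \sum_(i < M) t i M + \sum_(l < M.+1) t M l.
Proof.
rewrite /square_sum big_ord_recr/=.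
under eq_bigr do rewrite big_ord_recr/=.
by rewrite big_split/=; ring.
Qed.

Variables (p q : nat -> R).
Hypotheses (p_ge0 : forall i, 0 <= p i) (q_ge0 : forall l, 0 <= q l).
Let b i l := p i * q l.

(** The terms between two squares are compared one layer at a time. *)
Lemma square_sum_diff_le t M M' : (forall i l, `|t i l| <= b i l) -> (M <= M')%N ->
  `|square_sum t M' - square_sum t M| <= square_sum b M' - square_sum b M.
Proof.
move=> tb /subnK <-; elim: (M' - M)%N => [|k IH]; first
  by rewrite add0n !subrr normr0.
rewrite addSn; set m := (k + M)%N in IH *.
have split3 (f : nat -> R) : f m.+1 - f M = (f m.+1 - f m) + (f m - f M) by ring.
rewrite (split3 (square_sum t)) (split3 (square_sum b)).
apply: (le_trans (ler_normD _ _)); apply: lerD => //.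
rewrite !square_sumS; apply: (le_trans (ler_normD _ _)); apply: lerD;
  by apply: (le_trans (ler_norm_sum _ _ _)); apply: ler_sum.
Qed.

Lemma square_sum_mul M : square_sum b M = (\sum_(i < M) p i) * (\sum_(l < M) q l).
Proof. by rewrite /square_sum big_distrlr. Qed.

Variables (P Q : R).
Hypotheses (pP : forall M, \sum_(i < M) p i <= P)
  (qQ : forall M, \sum_(l < M) q l <= Q).

Lemma square_sum_bound_nd : nondecreasing_seq (square_sum b).
Proof.
apply/nondecreasing_seqP => M; rewrite -subr_ge0 square_sumS.
by rewrite addr_ge0// sumr_ge0// => i _; rewrite mulr_ge0.
Qed.

Lemma square_sum_bound_cvg : cvgn (square_sum b).
Proof.
apply: (nondecreasing_is_cvgn square_sum_bound_nd).
exists (P * Q) => _ [M _ <-]; rewrite square_sum_mul.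
by apply: ler_pM => //; exact: sumr_ge0.
Qed.

Lemma square_sum_tail e : 0 < e ->
  exists N0, forall M, (N0 <= M)%N -> square_sum b M - square_sum b N0 <= e.
Proof.
move=> e0; have h : limn (square_sum b) - e < limn (square_sum b)
  by rewrite ltrBlDr ltrDl.
have [N0 _ N0h] := cvgr_ge _ square_sum_bound_cvg _ h.
exists N0 => M N0M; rewrite lerBlDr.
apply: (le_trans (nondecreasing_cvgn_le square_sum_bound_nd square_sum_bound_cvg M)).
by rewrite -lerBlDl; apply: N0h => /=.
Qed.

Lemma square_sum_cvg t : (forall i l, `|t i l| <= b i l) -> cvgn (square_sum t).
Proof.
move=> tb; apply/cauchy_cvgP/cauchyP => e e0.
have e20 : 0 < e / 2 by rewrite divr_gt0.
have [N0 N0h] := square_sum_tail _ e20.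
exists (square_sum t N0); exists N0 => // M /= N0M.
rewrite /ball/= distrC; apply: (le_lt_trans (square_sum_diff_le t _ _ tb N0M)).
by apply: (le_lt_trans (N0h _ N0M)); rewrite ltr_pdivrMr// ltr_pMr// ltr1n.
Qed.

(** Tannery's theorem with a truncation that moves with M: a fixed square
    carries all but e / 3 of the dominating sum, hence of every t M and
    of u, and on that square the convergence is that of a finite sum. *)
Lemma dominated_square_sums (t : nat -> nat -> nat -> R) (u : nat -> nat -> R) :
  (forall M i l, `|t M i l| <= b i l) ->
  (forall i l, t M i l @[M --> \oo] --> u i l) ->
  cvgn (square_sum u) /\ square_sum (t M) M.+1 @[M --> \oo] --> limn (square_sum u).
Proof.
move=> tb tu.
have ub i l : `|u i l| <= b i l.
  apply: (ler_cvg_to (cvg_norm (tu i l)) (cvg_cst (b i l))).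
  exact: nearW.
have cu := square_sum_cvg u ub.
split=> //; apply/cvgrPdist_le => e e0.
have e30 : 0 < e / 3 by rewrite divr_gt0.
have [N0 N0h] := square_sum_tail _ e30.
have ct : square_sum (t M) N0 @[M --> \oo] --> square_sum u N0.
  by apply: cvg_sumr => i _; apply: cvg_sumr => l _; exact: tu.
have hu : `|limn (square_sum u) - square_sum u N0| <= e / 3.
  have c1 : `|square_sum u M - square_sum u N0| @[M --> \oo] -->
    `|limn (square_sum u) - square_sum u N0|.
    by apply: cvg_norm; apply: cvgB => //; exact: cvg_cst.
  apply: (ler_cvg_to c1 (cvg_cst (e / 3))).
  exists N0 => // M /= N0M.
  exact: (le_trans (square_sum_diff_le u _ _ ub N0M) (N0h _ N0M)).
near=> M.
have h1 : `|square_sum u N0 - square_sum (t M) N0| <= e / 3.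
  by near: M; move/cvgrPdist_le : ct; apply.
have N0M : (N0 <= M.+1)%N by apply: leqW; near: M; exact: nbhs_infty_ge.
have h2 : `|square_sum (t M) N0 - square_sum (t M) M.+1| <= e / 3.
  by rewrite distrC; exact: (le_trans (square_sum_diff_le _ _ _ (tb M) N0M)
    (N0h _ N0M)).
have -> : limn (square_sum u) - square_sum (t M) M.+1 =
  (limn (square_sum u) - square_sum u N0) + (square_sum u N0 - square_sum (t M) N0)
  + (square_sum (t M) N0 - square_sum (t M) M.+1) by ring.
apply: (le_trans (ler_normD _ _)).
apply: (le_trans (lerD (ler_normD _ _) (lexx _))).
lra.
Unshelve. all: by end_near. Qed.

End dominated_square_sums.

(** * Rescaled coefficients of the kernel *)
Section edge_coefficients.
Variable R : realType.
Variables (a theta : R).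
Hypotheses (a0 : 0 < a) (theta0 : 0 < theta).
Notation z_ := (node R a theta).
Notation s_ := (dual_node R a theta).
Notation Gamma := (Gamma R).

(** In the customary form of the kernel the last factor is
    theta / (a + i + theta l), which equals 1 / (z_i + l). *)
Definition edge_term (x Y : R) (i l : nat) : R :=
  ((-1) ^+ i * x ^+ i / (i`!%:R * Gamma (z_ i))) *
  ((-1) ^+ l * Y ^+ l / (l`!%:R * Gamma (s_ l))) / (z_ i + l%:R).

Definition rising_ratio M (z : R) : R :=
  (\prod_(k < M.+1) (z + k%:R)) / (M`!%:R * M.+1%:R `^ z).

Definition falling_ratio M l : R := (M ^_ l)%:R / M.+1%:R ^+ l.

(** The entry (i, l) of [inverse_Gram] for N = M + 1 points, divided by
    N^(z_i + l). Here M! and the powers of N are distributed so that each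
    factor has a limit and a bound of its own. *)
Definition scaled_coef M i l : R :=
  (-1) ^+ l / (i`!%:R * l`!%:R * Gamma (s_ l)) *
  \sum_(r < i.+1) 'C(i, r)%:R * ((-1) ^+ r *
     (rising_ratio M (z_ r) * falling_ratio M l * M.+1%:R `^ (z_ r - z_ i) /
      (z_ r + l%:R))).

Lemma rising_ratio_cvg z : 0 < z -> rising_ratio M z @[M --> \oo] --> (Gamma z)^-1.
Proof. exact: rising_asymptotic. Qed.

Lemma rising_ratio_ge0 M z : 0 < z -> 0 <= rising_ratio M z.
Proof.
by move=> z0; rewrite divr_ge0 ?mulr_ge0 ?powR_ge0// prodr_ge0// => k _;
  rewrite addr_ge0// ltW.
Qed.

Lemma rising_ratio_le M z : 0 < z -> rising_ratio M z <= z * expR z.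
Proof.
move=> z0; rewrite ler_pdivrMr ?mulr_gt0 ?powR_gt0 ?ltr0n ?fact_gt0//.
apply: (le_trans (rising_le _ z M z0)).
by rewrite le_eqVlt; apply/orP; left; apply/eqP; ring.
Qed.

Lemma falling_ratioE M l : falling_ratio M l = \prod_(k < l) ((M - k)%:R / M.+1%:R).
Proof.
rewrite /falling_ratio ffact_prod natr_prod -[l in _ ^+ l]card_ord.
by rewrite -prodr_const -prodf_div.
Qed.

Lemma falling_ratio_ge0 M l : 0 <= falling_ratio M l.
Proof. by rewrite divr_ge0. Qed.

Lemma falling_ratio_le1 M l : falling_ratio M l <= 1.
Proof.
rewrite falling_ratioE; apply: prodr_ile1 => k _.
by rewrite divr_ge0//= ler_pdivrMr// mul1r ler_nat (leq_trans (leq_subr _ _)).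
Qed.

Lemma falling_ratio_cvg l : falling_ratio M l @[M --> \oo] --> (1 : R).
Proof.
have -> : falling_ratio^~ l = (fun M => \prod_(k < l) ((M - k)%:R / M.+1%:R)).
  by apply/funext => M; exact: falling_ratioE.
rewrite [X in _ --> X](_ : _ = \prod_(k < l) (1 : R)); last by rewrite big1.
apply: cvg_prodr => k _.
have h : (1 + (- (k.+1%:R)) / M.+1%:R) @[M --> \oo] --> (1 : R)
  by exact: cvg_ratio_shift.
apply: cvg_trans h; apply: near_eq_cvg; exists k => // M /= kM.
rewrite natrB//; rewrite -!natr1; field.
by rewrite natr1 pnatr_eq0.
Qed.

Lemma powRN_cvg0 (c : R) : 0 < c -> (M.+1%:R `^ (- c)) @[M --> \oo] --> (0 : R).
Proof.
move=> c0.
have -> : (fun M => M.+1%:R `^ (- c)) = (fun M => (M.+1%:R^-1) `^ c) :> (nat -> R).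
  by apply/funext => M; rewrite -[M.+1%:R^-1]powR_inv1// -powRrM mulN1r.
move/cvg_at_rightP : (powR_cvg0 c0); apply; split => //.
exact: cvg_harmonic.
Qed.

(** The term of index r carries N^((r - i) / theta), so only r = i survives. *)
Lemma scaled_coef_cvg i l : scaled_coef M i l @[M --> \oo] -->
  (-1) ^+ l / (i`!%:R * l`!%:R * Gamma (s_ l)) *
  ((-1) ^+ i / (Gamma (z_ i) * (z_ i + l%:R))).
Proof.
apply: cvgMr.
have -> : (-1) ^+ i / (Gamma (z_ i) * (z_ i + l%:R)) =
  \sum_(r < i.+1) 'C(i, r)%:R *
    ((-1) ^+ r * ((Gamma (z_ r))^-1 * 1 * (r == i :> nat)%:R / (z_ r + l%:R))).
  rewrite big_ord_recr/= binn eqxx big1 ?add0r; last first.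
    by move=> r _; rewrite (ltn_eqF (ltn_ord r)) !(mulr0,mul0r).
  by rewrite !mul1r !mulr1 invfM.
apply: cvg_sumr => r _; do 2 apply: cvgMr; apply: cvgMl; apply: cvgM.
  apply: cvgM; last exact: falling_ratio_cvg.
  by apply: rising_ratio_cvg; exact: node_gt0.
have [->|ri] := eqVneq (r : nat) i.
  rewrite subrr (_ : (fun M => _) = cst 1); first exact: cvg_cst.
  by apply/funext => M; rewrite powRr0.
have -> : z_ r - z_ i = - ((i - r)%:R / theta).
  have ri' : (r <= i)%N by rewrite -ltnS; exact: ltn_ord.
  by rewrite natrB// /node -mulrBl opprD addrACA subrr addr0 -mulNr opprB.
apply: powRN_cvg0; rewrite divr_gt0// ltr0n subn_gt0 ltn_neqAle ri -ltnS;
  exact: ltn_ord.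
Qed.

(** A linear bound is enough: factorials in the other denominators already make
    the dominating sums converge. *)
Lemma Gamma_inv_le z : 0 < z -> (Gamma z)^-1 <= expR 1 * z.
Proof.
move=> z0; rewrite -[leRHS]invrK lef_pV2 ?posrE ?invr_gt0 ?mulr_gt0 ?expR_gt0
  ?Gamma_gt0//.
by rewrite invfM -expRN; exact: Gamma_ge.
Qed.

(** All powers of N in the sum are at most 1 because r <= i, the rising ratios
    are at most z e^z, where z is absorbed by the denominator z + l, and the
    binomial coefficients add up to 2^i. *)
Lemma scaled_coef_le M i l : `|scaled_coef M i l| <=
  (2 ^+ i * expR (z_ i) / i`!%:R) * (expR 1 * s_ l / l`!%:R).
Proof.
have dl0 : 0 < s_ l by exact: dual_node_gt0.
have f0 k : 0 < k`!%:R :> R by rewrite ltr0n fact_gt0.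
rewrite /scaled_coef normrM normrM normfV !normrM normr_sign mul1r.
rewrite (ger0_norm (ltW (f0 i))) (ger0_norm (ltW (f0 l)))
  (ger0_norm (ltW (Gamma_gt0 _ _ dl0))).
have sle : `|\sum_(r < i.+1) 'C(i, r)%:R * ((-1) ^+ r *
     (rising_ratio M (z_ r) * falling_ratio M l * M.+1%:R `^ (z_ r - z_ i) /
      (z_ r + l%:R)))| <= 2 ^+ i * expR (z_ i).
  have -> : 2 ^+ i = \sum_(r < i.+1) 'C(i, r)%:R :> R.
    by rewrite -[2]natr1 exprDn; apply: eq_bigr => r _; rewrite !expr1n mul1r.
  rewrite big_distrl/=; apply: (le_trans (ler_norm_sum _ _ _)); apply: ler_sum => r _.
  have ri : (r <= i)%N by rewrite -ltnS.
  have nr0 := node_gt0 R a theta a0 theta0 r.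
  have nri : z_ r <= z_ i.
    by rewrite /node ler_pM2r ?invr_gt0// lerD2r ler_nat.
  have nrl : 0 < z_ r + l%:R by rewrite ltr_wpDr.
  have rr0 := rising_ratio_ge0 M _ nr0.
  have fr0 := falling_ratio_ge0 M l.
  have pr0 := powR_ge0 (M.+1%:R : R) (z_ r - z_ i).
  rewrite normrM normr_nat ler_wpM2l// normrM normr_sign mul1r ger0_norm; last first.
    by rewrite divr_ge0 ?(ltW nrl)// mulr_ge0// mulr_ge0.
  rewrite ler_pdivrMr//.
  apply: (@le_trans _ _ (z_ r * expR (z_ r) * 1 * 1)).
    apply: ler_pM => //; first exact: mulr_ge0.
      apply: ler_pM => //; [exact: rising_ratio_le|exact: falling_ratio_le1].
    by rewrite -[leRHS](powRr0 M.+1%:R) ler_powR ?ler1n// subr_le0.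
  rewrite !mulr1 mulrC; apply: ler_pM; rewrite ?expR_ge0 ?(ltW nr0)//.
    by rewrite ler_expR.
  by rewrite lerDl.
apply: (@le_trans _ _ (1 / (i`!%:R * l`!%:R * Gamma (s_ l)) *
  (2 ^+ i * expR (z_ i)))).
  by rewrite div1r ler_wpM2l// invr_ge0 mulr_ge0 ?mulr_ge0// ltW// Gamma_gt0.
have -> : 1 / (i`!%:R * l`!%:R * Gamma (s_ l)) * (2 ^+ i * expR (z_ i)) =
   (2 ^+ i * expR (z_ i) / i`!%:R) * ((Gamma (s_ l))^-1 / l`!%:R).
  by field; rewrite !gt_eqF// Gamma_gt0.
rewrite ler_wpM2l ?divr_ge0 ?mulr_ge0 ?expR_ge0//.
by rewrite ler_wpM2r ?invr_ge0// Gamma_inv_le.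
Qed.

Lemma scaled_coefE M (i l : 'I_M.+1) :
  inverse_Gram R a theta M.+1 i l * M.+1%:R `^ (- (z_ i + l%:R)) = scaled_coef M i l.
Proof.
rewrite /inverse_Gram /node_difference /scaled_coef -[LHS]mulrA; congr (_ * _).
rewrite big_distrl/=; apply: eq_bigr => r _; rewrite -[LHS]mulrA; congr (_ * _).
rewrite -[LHS]mulrA; congr (_ * _).
have lM : (l <= M)%N by rewrite -ltnS.
have nr0 := node_gt0 R a theta a0 theta0 r.
have nrl : z_ r + l%:R != 0 by rewrite gt_eqF// ltr_wpDr.
rewrite /punctured_rising /rising_ratio /falling_ratio subSS [in RHS](bigD1 l)//=.
move: (\prod_(k < M.+1 | k != l) _) => X.
have N0 : (M.+1%:R : R) != 0 by rewrite pnatr_eq0.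
rewrite opprD !powRD ?N0 ?implybT// powRN [M.+1%:R `^ (- l%:R)]powRN powR_mulrn//.
have -> : M`! = (M ^_ l * (M - l)`!)%N by rewrite ffact_fact.
rewrite natrM.
have F0 : ((M ^_ l)%:R : R) != 0 by rewrite pnatr_eq0 -lt0n ffact_gt0.
have G0 : ((M - l)`!%:R : R) != 0 by rewrite pnatr_eq0 -lt0n fact_gt0.
have p0 z : (M.+1%:R : R) `^ z != 0 by rewrite gt_eqF// powR_gt0.
have q0 : (M.+1%:R : R) ^+ l != 0 by rewrite expf_neq0.
move: (p0 (z_ r)) (p0 (z_ i)) N0 F0 G0 q0 nrl.
move: (M.+1%:R `^ z_ r) (M.+1%:R `^ z_ i) (M.+1%:R ^+ l) ((M ^_ l)%:R) ((M - l)`!%:R)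
  (z_ r + l%:R).
move=> A B D E F z A0 B0 _ E0 F0 D0 z0.
by field; rewrite A0 B0 D0 E0 F0 z0.
Qed.

Lemma sum_exp_coeff_le (z : R) M : 0 <= z -> \sum_(i < M) z ^+ i / i`!%:R <= expR z.
Proof.
move=> z0; have -> : \sum_(i < M) z ^+ i / i`!%:R = series (exp_coeff z) M.
  by rewrite /series/= big_mkord; apply: eq_bigr => i _; rewrite /exp_coeff.
apply: (nondecreasing_cvgn_le _ (is_cvg_series_exp_coeff z)).
by apply: nondecreasing_series => i _ _; rewrite /exp_coeff divr_ge0// exprn_ge0.
Qed.

(** Replacing the linear growth in l by 2^l turns the dominating series into an
    exponential one. *)
Lemma dual_node_le l : s_ l <= (theta + a) * 2 ^+ l.
Proof.
rewrite /dual_node mulrDl; apply: lerD.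
  by rewrite ler_wpM2l// ?(ltW theta0)// -natrX ler_nat ltnW// ltn_expl.
by rewrite ler_peMr ?(ltW a0)// exprn_ege1// ler1n.
Qed.

Section edge_sums.
Variables (x Y : R).
Hypotheses (x0 : 0 <= x) (Y0 : 0 <= Y).

(* The dominating product; p grows at most like (2 e^(1/theta) x)^i / i!, since
   z_i is affine in i. *)
Let p i := 2 ^+ i * expR (z_ i) / i`!%:R * x ^+ i.
Let q l := expR 1 * s_ l / l`!%:R * Y ^+ l.

Let p_ge0 i : 0 <= p i.
Proof. by rewrite mulr_ge0 ?exprn_ge0// divr_ge0 ?mulr_ge0 ?expR_ge0. Qed.

Let q_ge0 l : 0 <= q l.
Proof.
rewrite mulr_ge0 ?exprn_ge0// divr_ge0 ?mulr_ge0 ?expR_ge0//.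
by apply: ltW; exact: dual_node_gt0.
Qed.

Let sum_p_le M : \sum_(i < M) p i <= expR (a / theta) * expR (2 * expR theta^-1 * x).
Proof.
have z0 : 0 <= 2 * expR theta^-1 * x by rewrite !mulr_ge0 ?expR_ge0.
apply: (le_trans _ (ler_wpM2l (expR_ge0 (a / theta)) (sum_exp_coeff_le _ M z0))).
rewrite big_distrr/=; apply: ler_sum => i _.
rewrite /p /node mulrDl expRD !exprMn -expRM_natl.
by rewrite le_eqVlt; apply/orP; left; apply/eqP; ring.
Qed.

Let sum_q_le M : \sum_(l < M) q l <= expR 1 * (theta + a) * expR (2 * Y).
Proof.
have z0 : 0 <= 2 * Y by rewrite mulr_ge0.
have c0 : 0 <= expR 1 * (theta + a) by rewrite mulr_ge0 ?expR_ge0// addr_ge0// ltW.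
apply: (@le_trans _ _ (expR 1 * (theta + a) * \sum_(l < M) (2 * Y) ^+ l / l`!%:R));
  last first.
  by apply: ler_wpM2l => //; exact: sum_exp_coeff_le.
rewrite big_distrr/=; apply: ler_sum => l _.
rewrite /q exprMn.
have -> : expR 1 * (theta + a) * (2 ^+ l * Y ^+ l / l`!%:R) =
  expR 1 * ((theta + a) * 2 ^+ l) / l`!%:R * Y ^+ l by ring.
rewrite ler_wpM2r ?exprn_ge0// ler_wpM2r ?invr_ge0// ler_wpM2l ?expR_ge0//.
exact: dual_node_le.
Qed.

Lemma scaled_sums_cvg : cvgn (square_sum R (edge_term x Y)) /\
  square_sum R (fun i l => scaled_coef M i l * (x ^+ i * Y ^+ l)) M.+1 @[M --> \oo]
   --> limn (square_sum R (edge_term x Y)).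
Proof.
apply: (dominated_square_sums R p q p_ge0 q_ge0 _ _ sum_p_le sum_q_le) => [M i l|i l].
  rewrite normrM (ger0_norm (mulr_ge0 (exprn_ge0 i x0) (exprn_ge0 l Y0))).
  rewrite /p /q mulrACA; apply: ler_wpM2r; first by rewrite mulr_ge0 ?exprn_ge0.
  exact: scaled_coef_le.
have -> : edge_term x Y i l = (-1) ^+ l / (i`!%:R * l`!%:R * Gamma (s_ l)) *
  ((-1) ^+ i / (Gamma (z_ i) * (z_ i + l%:R))) * (x ^+ i * Y ^+ l).
  have nr0 := node_gt0 R a theta a0 theta0 i.
  have nrl : z_ i + l%:R != 0 by rewrite gt_eqF// ltr_wpDr.
  have f0 k : (k`!%:R : R) != 0 by rewrite pnatr_eq0 -lt0n fact_gt0.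
  have g0 : Gamma (z_ i) != 0 by rewrite gt_eqF// Gamma_gt0.
  have h0 : Gamma (s_ l) != 0 by rewrite gt_eqF// Gamma_gt0// dual_node_gt0.
  rewrite /edge_term; move: nrl (f0 i) (f0 l) g0 h0.
  move: (z_ i + l%:R) (i`!%:R) (l`!%:R) (Gamma _) (Gamma _) =>
    A B D E F A0 B0 D0 E0 F0.
  by field; rewrite A0 B0 D0 E0 F0.
by apply: cvgMl; exact: scaled_coef_cvg.
Qed.

End edge_sums.

Definition edge_kernel (x y : R) : R :=
  limn (square_sum R (edge_term x (y `^ theta))).

End edge_coefficients.

(** * The limit correlation functions at the left edge *)
Section edge_limit.
Variable R : realType.
Variables (alpha theta : R).
Hypotheses (alpha_gtN1 : -1 < alpha) (theta_gt0 : 0 < theta).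
Notation RR := (measurableTypeR R).
Let a := alpha + 1.
Let a_gt0 : 0 < a. Proof. by rewrite -ltrBlDr sub0r. Qed.

Definition prelimit_kernel M (x y : R) : R :=
  square_sum R
    (fun i l => scaled_coef R a theta M i l * (x ^+ i * (y `^ theta) ^+ l)) M.+1.

(** The exponent z_i + l = a / theta + i / theta + l is shared between the
    prefactor, the rescaling of x^i and the rescaling of y^(theta l). *)
Lemma Laguerre_kernel_scaled M (x y : R) : 0 < x -> 0 < y ->
  M.+1%:R `^ (- (a / theta)) *
    Laguerre_kernel R alpha theta M.+1 (x / M.+1%:R `^ theta^-1)
      (y / M.+1%:R `^ theta^-1)
  = prelimit_kernel M x y.
Proof.
move=> x0 y0; rewrite /Laguerre_kernel /prelimit_kernel /square_sum exchange_big/=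
  big_distrr/=.
apply: eq_bigr => l _; rewrite /dual_poly big_distrl big_distrr/=;
  apply: eq_bigr => i _.
rewrite -scaled_coefE//.
have N0 : (0 : R) < M.+1%:R by rewrite ltr0n.
have Nadd b c : (M.+1%:R : R) `^ b * M.+1%:R `^ c = M.+1%:R `^ (b + c).
  by rewrite powRD// (gt_eqF N0) implybT.
have -> : theta_monomial R theta l (y / M.+1%:R `^ theta^-1) = (y `^ theta) ^+ l *
  M.+1%:R `^ (- l%:R).
  rewrite /theta_monomial powRM ?(ltW y0) ?invr_ge0 ?powR_ge0// exprMn; congr (_ * _).
  rewrite -[_^-1]powRN -powRrM mulNr mulVf ?(gt_eqF theta_gt0)//.
  by rewrite powRN powRr1// powRN powR_mulrn// exprVn.
have -> : (x / M.+1%:R `^ theta^-1) ^+ i = x ^+ i * M.+1%:R `^ (- (i%:R / theta)).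
  rewrite exprMn; congr (_ * _).
  by rewrite exprVn -powR_mulrn ?powR_ge0// -powRrM powRN [i%:R / _]mulrC.
have -> : M.+1%:R `^ (- (node R a theta i + l%:R)) =
  M.+1%:R `^ (- (a / theta)) * (M.+1%:R `^ (- (i%:R / theta)) * M.+1%:R `^ (- l%:R))
    :> R.
  rewrite !Nadd; congr (_ `^ _); rewrite /node; ring.
rewrite -/a; ring.
Qed.

Lemma Laguerre_weight_scaled M (x : R) : 0 < x ->
  Laguerre_weight R alpha (x / M.+1%:R `^ theta^-1) =
  M.+1%:R `^ (- (alpha / theta)) * (x `^ alpha * expR (- (x / M.+1%:R `^ theta^-1))).
Proof.
move=> x0; rewrite /Laguerre_weight powRM ?(ltW x0) ?invr_ge0 ?powR_ge0//.
rewrite -[(M.+1%:R `^ _)^-1]powRN -[(_ `^ (- theta^-1)) `^ _]powRrM mulNr.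
by rewrite [theta^-1 * _]mulrC mulrCA mulrA.
Qed.

(** Each variable contributes N^(-1 / theta) from the scale and
    N^(-alpha / theta) from its weight; together they make up the factor
    N^(-a / theta) of one row of the determinant. *)
Lemma Lag_correlation_scaled n M (x : n.-tuple R) :
  (n <= M.+1)%N -> (forall k, 0 < tnth x k) ->
  (M.+1%:R `^ (n%:R / theta))^-1 * Lag_correlation alpha theta M.+1
      (map_tuple (fun t => t / M.+1%:R `^ theta^-1) x)
  = \det (\matrix_(i, j) prelimit_kernel M (tnth x i) (tnth x j)) *
    \prod_k (tnth x k `^ alpha * expR (- (tnth x k / M.+1%:R `^ theta^-1))).
Proof.
move=> nM x0.
rewrite /Lag_correlation -[X in X`!%:R / _](subnKC nM) Lag_density_marginal//
  subnKC//.
set K := \matrix_(i, j) _.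
have N0 : (0 : R) < M.+1%:R by rewrite ltr0n.
have -> : \matrix_(i, j) prelimit_kernel M (tnth x i) (tnth x j) =
   M.+1%:R `^ (- (a / theta)) *: K.
  by apply/matrixP => i j; rewrite !mxE !tnth_map Laguerre_kernel_scaled.
rewrite detZ.
under eq_bigr do rewrite tnth_map Laguerre_weight_scaled//.
rewrite big_split/= prodr_const card_ord -!mulrA mulrCA [RHS]mulrCA; congr (_ * _).
rewrite mulrA; congr (_ * _).
rewrite -powRN -!powR_mulrn ?powR_ge0// -!powRrM -powRD ?(gt_eqF N0) ?implybT//.
congr (_ `^ _); rewrite /a; ring.
Qed.

Definition edge_correlation n (x : n.-tuple R) : R :=
  (\prod_k tnth x k `^ alpha) *
  \det (\matrix_(i, j) edge_kernel R a theta (tnth x i) (tnth x j)).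

Lemma prelimit_kernel_cvg (x y : R) : 0 < x -> 0 < y ->
  prelimit_kernel M x y @[M --> \oo] --> edge_kernel R a theta x y.
Proof.
move=> x0 y0.
by have [] := scaled_sums_cvg R a theta a_gt0 theta_gt0 x (y `^ theta) (ltW x0)
  (powR_ge0 _ _).
Qed.

Definition rescaled_correlation n (x : n.-tuple R) N : R :=
  (N%:R `^ (n%:R / theta))^-1 *
    Lag_correlation alpha theta N (map_tuple (fun t => t / N%:R `^ theta^-1) x).

Lemma rescaled_correlation_cvg n (x : n.-tuple R) : (forall k, 0 < tnth x k) ->
  rescaled_correlation n x N @[N --> \oo] --> edge_correlation n x.
Proof.
move=> x0; rewrite -cvg_shiftS/=.
have h : \det (\matrix_(i, j) prelimit_kernel M (tnth x i) (tnth x j)) *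
    \prod_k (tnth x k `^ alpha * expR (- (tnth x k / M.+1%:R `^ theta^-1)))
   @[M --> \oo] --> edge_correlation n x.
  rewrite /edge_correlation mulrC; apply: cvgM.
    by apply: cvg_det => i j; exact: prelimit_kernel_cvg.
  apply: cvg_prodr => k _; rewrite -[X in _ --> X]mulr1; apply: cvgMr.
  rewrite -[X in _ --> X]expR0; apply: continuous_cvg; first exact: continuous_expR.
  rewrite -[X in _ --> X]oppr0; apply: cvgN.
  rewrite -[X in _ --> X](mulr0 (tnth x k)); apply: cvgMr.
  have -> : (fun M => (M.+1%:R `^ theta^-1)^-1) =
    (fun M => M.+1%:R `^ (- theta^-1)) :> (nat -> R).
    by apply/funext => M; rewrite powRN.
  by apply: powRN_cvg0; rewrite invr_gt0.
apply: cvg_trans h; apply: near_eq_cvg; exists n => // M /= nM.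
by rewrite /rescaled_correlation Lag_correlation_scaled// leqW.
Qed.

Lemma Lag_edge_correlationE n (x : n.-tuple R) : (forall k, 0 < tnth x k) ->
  Lag_edge_correlation alpha theta x = edge_correlation n x.
Proof. by move=> x0; apply/cvg_lim => //; exact: rescaled_correlation_cvg. Qed.

Lemma Lag_weight_ge0 N (z : N.-tuple R) : (forall k, 0 < tnth z k) ->
  0 <= Lag_weight alpha theta z.
Proof.
move=> z0; rewrite /Lag_weight !mulr_ge0 ?expR_ge0//; last first.
  by apply: prodr_ge0 => i _; exact: powR_ge0.
apply: prodr_ge0 => i _; apply: prodr_ge0 => j _.
have mono u v : 0 < u -> 0 < v -> u <= v -> u `^ theta <= v `^ theta.
  by move=> u0 v0 uv; rewrite ge0_ler_powR ?nnegrE ?(ltW u0) ?(ltW v0)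
    ?(ltW theta_gt0).
have [ij|ji] := leP (tnth z i) (tnth z j).
  by rewrite mulr_le0// subr_le0//; exact: mono.
by rewrite mulr_ge0// subr_ge0 ?(ltW ji)//; apply: mono => //; exact: ltW.
Qed.

Lemma Lag_correlation_ge0 n N (x : n.-tuple R) : (forall k, 0 < tnth x k) ->
  0 <= Lag_correlation alpha theta N x.
Proof.
move=> x0; rewrite /Lag_correlation mulr_ge0//.
apply: Rintegral_ge0 => y y0; rewrite /Lag_density mulr_ge0//.
  by rewrite invr_ge0; apply: Rintegral_ge0 => u u0; exact: Lag_weight_ge0.
apply: Lag_weight_ge0 => k; rewrite -[k]splitK.
by case: (fintype.split k) => i /=; rewrite ?tnth_lshift ?tnth_rshift//; exact: y0.
Qed.

(** Not visible on the determinant, but inherited from the densities through the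
    limit. It allows the change of variables without any integrability. *)
Lemma edge_correlation_ge0 n (x : n.-tuple R) : (forall k, 0 < tnth x k) ->
  0 <= edge_correlation n x.
Proof.
move=> x0; apply: (ler_cvg_to (cvg_cst 0) (rescaled_correlation_cvg n x x0)).
exists 1%N => // N /= N0; rewrite mulr_ge0 ?invr_ge0 ?powR_ge0//.
apply: Lag_correlation_ge0 => k; rewrite tnth_map divr_gt0// powR_gt0// ltr0n.
exact: N0.
Qed.

Lemma measurable_prelimit_kernel n M (i j : 'I_n) (D : set (n.-tuple RR)) :
  measurable_fun D (fun x : n.-tuple RR => prelimit_kernel M (tnth x i) (tnth x j)).
Proof.
apply: measurable_funTS; apply: measurable_sum => k; apply: measurable_sum => l.
apply: measurable_funM => //; apply: measurable_funM; apply: measurable_funX.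
  exact: measurable_tnth.
apply: (measurableT_comp (measurable_powR theta)).
exact: measurable_tnth.
Qed.

Lemma measurable_det d (T : measurableType d) n (A : 'I_n -> 'I_n -> T -> R)
  (D : set T) :
  (forall i j, measurable_fun D (A i j)) ->
  measurable_fun D (fun x => \det (\matrix_(i, j) A i j x)).
Proof.
move=> mA; apply: measurable_sum => s; apply: measurable_funM => //.
have -> : (fun x => \prod_i (\matrix_(i, j) A i j x) i (s i)) =
  (fun x => \prod_i A i (s i) x).
  by apply/funext => x; apply: eq_bigr => i _; rewrite mxE.
by apply: measurable_prod => i _; exact: mA.
Qed.

Lemma measurable_edge_correlation n :
  measurable_fun (orthant R n) (fun x : n.-tuple RR => edge_correlation n x).
Proof.
apply: measurable_funM.
  apply: measurable_prod => k _; apply: measurable_funTS.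
  by apply: (measurableT_comp (measurable_powR alpha)); exact: measurable_tnth.
apply: measurable_det => i j.
apply: (@measurable_fun_cvg _ _ _ _ (fun M (x : n.-tuple RR) =>
  prelimit_kernel M (tnth x i) (tnth x j))).
  by move=> M; exact: measurable_prelimit_kernel.
by move=> x x0; exact: prelimit_kernel_cvg.
Qed.

End edge_limit.

(** * The substitution of a power in each coordinate *)
Section power_substitution.
Variable R : realType.
Notation mu := (@lebesgue_measure R).
Notation RR := (measurableTypeR R).

(** Extended by the identity to the negative half-line: the image of the measure
    with density [power_jacobian] is then Lebesgue measure on the whole line,
    which is determined by its values on half-open intervals. *)
Definition power_map (theta t : R) : R := if 0 < t then t `^ theta else t.

Definition power_jacobian (theta t : R) : R :=
  if 0 < t then `|theta| * t `^ (theta - 1) else 1.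

Lemma measurable_power_map theta : measurable_fun setT (power_map theta : RR -> RR).
Proof.
by apply: measurable_fun_ifT => //; exact: measurable_fun_ltr.
Qed.

Lemma measurable_power_jacobian theta :
  measurable_fun setT (power_jacobian theta : RR -> RR).
Proof.
apply: measurable_fun_ifT => //; first exact: measurable_fun_ltr.
by apply: measurable_funM => //; exact: measurable_powR.
Qed.

Lemma power_jacobian_ge0 theta t : 0 <= power_jacobian theta t.
Proof. by rewrite /power_jacobian; case: ifP => // _; rewrite mulr_ge0 ?powR_ge0. Qed.

Definition power_image_measure (theta : R) (A : set RR) : \bar R :=
  (\int[mu]_(t in power_map theta @^-1` A) (power_jacobian theta t)%:E)%E.

Let power_image_measure0 theta : power_image_measure theta set0 = 0%E.
Proof. by rewrite /power_image_measure preimage_set0 integral_set0. Qed.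

Let power_image_measure_ge0 theta A : (0 <= power_image_measure theta A)%E.
Proof. by apply: integral_ge0 => t _; rewrite lee_fin power_jacobian_ge0. Qed.

Lemma measurable_power_preimage theta (A : set RR) :
  measurable A -> measurable (power_map theta @^-1` A : set RR).
Proof.
by move=> mA; rewrite -[X in measurable X]setTI; exact: measurable_power_map.
Qed.

Let power_image_measure_sigma_additive theta :
  semi_sigma_additive (power_image_measure theta).
Proof.
move=> /= F mF tF mUF; rewrite /power_image_measure; apply: cvg_toP.
  apply: ereal_nondecreasing_is_cvgn => m n mn.
  apply: lee_sum_nneg_natr => // k _ _; exact: power_image_measure_ge0.
rewrite preimage_bigcup ge0_integral_bigcup//=.
- by move=> k; exact: measurable_power_preimage.
- by apply/measurable_funTS/measurable_EFinP; exact: measurable_power_jacobian.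
- by move=> x _; rewrite lee_fin power_jacobian_ge0.
- apply/trivIsetP => /= i j _ _ ij; rewrite -preimage_setI.
  by move/trivIsetP : tF => /(_ _ _ _ _ ij) ->//; rewrite preimage_set0.
Qed.

HB.instance Definition _ theta := isMeasure.Build _ _ _ (power_image_measure theta)
  (power_image_measure0 theta) (power_image_measure_ge0 theta)
  (@power_image_measure_sigma_additive theta).

Variable theta : R.
Hypothesis theta_gt0 : 0 < theta.

Let powRK (c : R) : 0 <= c -> (c `^ theta^-1) `^ theta = c.
Proof. by move=> c0; rewrite -powRrM mulVf ?gt_eqF// powRr1. Qed.

Lemma ltr_powR_inv (c t : R) : 0 <= c -> 0 < t -> (c < t `^ theta) =
  (c `^ theta^-1 < t).
Proof.
move=> c0 t0; apply/idP/idP => h.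
  rewrite ltNge; apply: contraTN h => h; rewrite -leNgt -[leRHS](powRK _ c0).
  by rewrite ge0_ler_powR ?nnegrE ?powR_ge0 ?(ltW theta_gt0) ?(ltW t0).
by rewrite -[ltLHS](powRK _ c0) gt0_ltr_powR// ?nnegrE ?powR_ge0 ?(ltW t0).
Qed.

Lemma power_image_measure_pos (a b : R) : 0 <= a -> a < b ->
  power_image_measure theta `]a, b]%classic = (b - a)%:E.
Proof.
move=> a0 ab; have b0 := le_lt_trans a0 ab.
have b'0 : 0 < b `^ theta^-1 by rewrite powR_gt0.
have ab' : a `^ theta^-1 < b `^ theta^-1 by rewrite gt0_ltr_powR// ?invr_gt0
  ?nnegrE ?(ltW b0).
rewrite /power_image_measure.
have -> : power_map theta @^-1` `]a, b]%classic =
    `]a `^ theta^-1, b `^ theta^-1]%classic :> set R.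
  apply/seteqP; split => t /=; rewrite !in_itv/= /power_map; case: ifPn => t0.
  - by rewrite ltr_powR_inv// => /andP[-> h] /=; rewrite leNgt -ltr_powR_inv
    ?(ltW b0)// -leNgt.
  - by move=> /andP[at_ _]; move: t0; rewrite (le_lt_trans a0 at_).
  - by rewrite ltr_powR_inv// => /andP[-> h] /=; rewrite leNgt ltr_powR_inv
    ?(ltW b0)// -leNgt.
  - by move=> /andP[at_ _]; move: t0; rewrite (le_lt_trans (powR_ge0 _ _) at_).
rewrite (eq_integral (fun t : RR => (theta * t `^ (theta - 1))%:E)); last first.
  move=> t; rewrite inE/= in_itv/= => /andP[t0 _].
  by rewrite /power_jacobian (le_lt_trans (powR_ge0 _ _) t0) gtr0_norm.
move: a0; rewrite le_eqVlt => /predU1P[<-|a0].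
  by rewrite powR0 ?gt_eqF ?invr_gt0// integral_powR// powRK ?(ltW b0)// subr0.
rewrite integral_itv_obnd_cbnd; last exact: measurable_powR_density.
by rewrite integral_powR_compact ?powR_gt0// !powRK ?ltW.
Qed.

Lemma power_image_measure_neg (a b : R) : b <= 0 -> a < b ->
  power_image_measure theta `]a, b]%classic = (b - a)%:E.
Proof.
move=> b0 ab; rewrite /power_image_measure.
have -> : power_map theta @^-1` `]a, b]%classic = `]a, b]%classic :> set R.
  apply/seteqP; split => t /=; rewrite !in_itv/= /power_map; case: ifPn => t0 //.
    by move=> /andP[_ h]; have := le_lt_trans (le_trans h b0) (powR_gt0 theta t0);
      rewrite ltxx.
  by move=> /andP[_ h]; have := le_lt_trans (le_trans h b0) t0; rewrite ltxx.
rewrite (eq_integral (cst 1%E : RR -> \bar R)); last first.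
  move=> t; rewrite inE/= in_itv/= => /andP[_ tb].
  by rewrite /power_jacobian ltNge (le_trans tb b0).
rewrite integral_cst//= mul1e lebesgue_measure_itv/= lte_fin ab.
by rewrite EFinB.
Qed.

(** An interval containing 0 in its interior is cut there; on each side the
    measure is known. *)
Lemma lebesgue_power_image_measure (A : set RR) : measurable A ->
  mu A = power_image_measure theta A.
Proof.
apply: lebesgue_measure_unique => _ [[a b]] _ <-/=.
rewrite lebesgue_measure_itv/= lte_fin; case: ifPn => ab; last first.
  by rewrite set_itv_ge ?measure0// bnd_simp.
rewrite -EFinB; have [b0|b0] := leP b 0; first by rewrite power_image_measure_neg.
have [a0|a0] := leP 0 a; first by rewrite power_image_measure_pos.
have -> : `]a, b]%classic = `]a, 0]%classic `|` `]0, b]%classic :> set R.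
  by rewrite -itv_bndbnd_setU// bnd_simp ltW.
rewrite measureU//=; last first.
  apply/seteqP; split => // t [] /=; rewrite !in_itv/= => /andP[_ t0] /andP[t0' _].
  by have := lt_le_trans t0' t0; rewrite ltxx.
by rewrite power_image_measure_neg// power_image_measure_pos// -EFinD;
  congr EFin; ring.
Qed.

Import HBNNSimple.

Lemma nnsfun_integral_power_map (h : {nnsfun RR >-> R}) :
  (\int[mu]_y (h y)%:E =
   \int[mu]_t ((power_jacobian theta t)%:E * (h (power_map theta t))%:E))%E.
Proof.
have mj := measurable_power_jacobian theta.
have mcomp (r : R) : measurable_fun setT (fun t : RR =>
  \1_(h @^-1` [set r]) (power_map theta t) : R).
  have mi : measurable_fun setT (\1_(h @^-1` [set r]) : RR -> R) by [].
  exact: (measurableT_comp mi (measurable_power_map theta)).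
under [LHS]eq_integral do rewrite fimfunE -fsumEFin//.
rewrite [LHS]ge0_integral_fsum//; last 2 first.
  - by move=> r; exact/measurable_EFinP/measurableT_comp.
  - by move=> n x _; rewrite EFinM nnfun_muleindic_ge0.
under [RHS]eq_integral.
  move=> x xD; rewrite fimfunE -fsumEFin// ge0_mule_fsumr; last first.
    by move=> r; rewrite EFinM nnfun_muleindic_ge0.
  over.
rewrite [RHS]ge0_integral_fsum//; last 2 first.
  - move=> r; apply/measurable_EFinP; apply: measurable_funM => //.
    exact: measurable_funM.
  - by move=> n x _; rewrite EFinM mule_ge0 ?nnfun_muleindic_ge0// lee_fin
    power_jacobian_ge0.
apply: eq_fsbigr => r; rewrite inE => -[y _ <-].
have hy0 : (0 <= (h y)%:E)%E by rewrite lee_fin.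
under eq_integral do rewrite EFinM.
rewrite ge0_integralZl//; last first.
  exact/measurable_EFinP.
under [RHS]eq_integral do rewrite EFinM muleCA.
rewrite ge0_integralZl//; last 2 first.
- by apply/measurable_EFinP; apply: measurable_funM.
- by move=> x _; rewrite mule_ge0// lee_fin// power_jacobian_ge0.
congr (_ * _)%E; rewrite integral_indic// setIT.
transitivity (power_image_measure theta (h @^-1` [set h y])).
  exact: lebesgue_power_image_measure.
rewrite /power_image_measure [LHS]integral_mkcond; apply: eq_integral => t _.
rewrite patchE indicE.
have -> : (t \in power_map theta @^-1` (h @^-1` [set h y])) =
  (power_map theta t \in h @^-1` [set h y]).
  by apply/idP/idP; rewrite !inE.
by case: ifP; rewrite ?mule1 ?mule0.
Qed.

(** From indicators to simple functions, then by monotone convergence. *)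
Lemma ge0_integral_power_map (f : RR -> \bar R) :
  measurable_fun setT f -> (forall y, (0 <= f y)%E) ->
  (\int[mu]_y f y =
   \int[mu]_t ((power_jacobian theta t)%:E * f (power_map theta t)))%E.
Proof.
move=> mf f0; pose f_ := nnsfun_approx measurableT mf.
have nd y m n : (m <= n)%N -> f_ m y <= f_ n y.
  by move=> mn; exact/lefP/nd_nnsfun_approx.
have mj : measurable_fun setT (fun t : RR => (power_jacobian theta t)%:E).
  by apply/measurable_EFinP; exact: measurable_power_jacobian.
have j0 t : (0 <= (power_jacobian theta t)%:E)%E
  by rewrite lee_fin power_jacobian_ge0.
transitivity (lim (\int[mu]_x (f_ n x)%:E @[n --> \oo])%E).
  rewrite -monotone_convergence//=.
  - apply: eq_integral => y _; apply/esym/cvg_lim => //=.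
    exact: cvg_nnsfun_approx.
  - by move=> n; exact/measurable_EFinP/measurable_funTS.
  - by move=> n y _; rewrite lee_fin.
  - by move=> y _ m n mn; rewrite lee_fin; exact: nd.
transitivity (lim (\int[mu]_t ((power_jacobian theta t)%:E *
  (f_ n (power_map theta t))%:E)
    @[n --> \oo])%E).
  by apply: congr_lim; apply/funext => n; exact: nnsfun_integral_power_map.
rewrite -monotone_convergence//=.
- apply: eq_integral => t _; apply/cvg_lim => //=.
  apply: cvgeZl => //; exact: cvg_nnsfun_approx.
- move=> n; apply: emeasurable_funM => //; apply/measurable_EFinP.
  have mi : measurable_fun setT (f_ n : RR -> R) by [].
  exact: (measurableT_comp mi (measurable_power_map theta)).
- by move=> n t _; rewrite mule_ge0// lee_fin.
- by move=> t _ m n mn; apply: lee_wpmul2l => //; rewrite lee_fin; exact: nd.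
Qed.

(** Positivity is recorded by a factor rather than by a domain of integration, so
    that it multiplies along the coordinates of a tuple. *)
Definition pos_indic (t : R) : R := (0 < t)%R%:R.
Definition power_weight (t : R) : R := pos_indic t * (theta * t `^ (theta - 1)).

Lemma pos_indic_ge0 t : 0 <= pos_indic t. Proof. exact: ler0n. Qed.

Lemma power_weight_ge0 t : 0 <= power_weight t.
Proof. by rewrite mulr_ge0 ?pos_indic_ge0// mulr_ge0 ?powR_ge0// ltW. Qed.

Lemma measurable_pos_indic : measurable_fun setT (pos_indic : RR -> RR).
Proof.
rewrite (_ : pos_indic = fun t => if 0 < t then 1 else 0).
  by apply: measurable_fun_ifT => //; exact: measurable_fun_ltr.
by apply/funext => t; rewrite /pos_indic; case: ifP.
Qed.

Lemma measurable_power_weight : measurable_fun setT (power_weight : RR -> RR).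
Proof.
apply: measurable_funM; first exact: measurable_pos_indic.
by apply: measurable_funM => //; exact: measurable_powR.
Qed.

Lemma ge0_integral_power (f : RR -> \bar R) :
  measurable_fun setT f -> (forall y, (0 <= f y)%E) ->
  (\int[mu]_y ((pos_indic y)%:E * f y) =
    \int[mu]_t ((power_weight t)%:E * f (t `^ theta)%R))%E.
Proof.
move=> mf f0; rewrite ge0_integral_power_map; last 2 first.
- by apply: emeasurable_funM => //; apply/measurable_EFinP;
  exact: measurable_pos_indic.
- by move=> y; rewrite mule_ge0// lee_fin pos_indic_ge0.
apply: eq_integral => t _;
  rewrite /power_jacobian /power_weight /power_map /pos_indic.
have [t0|t0] := ltP 0 t; last by rewrite ltNge t0/= !(mul0r, mul0e, mule0).
by rewrite powR_gt0//= mul1e mul1r gtr0_norm.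
Qed.

Definition power_tuple n (x : n.-tuple RR) : n.-tuple RR :=
  map_tuple (fun t : R => t `^ theta) x.
Local Arguments power_tuple {n}.

Lemma measurable_power_tuple n : measurable_fun setT (@power_tuple n).
Proof.
apply/measurable_fun_tnthP => i.
rewrite (_ : _ \o _ = fun x : n.-tuple RR => (tnth x i `^ theta : RR)); last first.
  by apply/funext => x; rewrite /= /power_tuple tnth_map.
have mp : measurable_fun setT (fun t : RR => (t `^ theta : RR))
  by exact: measurable_powR.
by apply: (measurableT_comp mp); exact: measurable_tnth.
Qed.

Lemma measurable_tuple_prod n (w : RR -> RR) : measurable_fun setT w ->
  measurable_fun setT (fun x : n.-tuple RR => (\prod_k w (tnth x k))%:E).
Proof.
move=> mw; apply/measurable_EFinP; apply: measurable_prod => k _.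
by apply: measurableT_comp => //; exact: measurable_tnth.
Qed.

Lemma power_tuple_cons n t (y : n.-tuple RR) :
  power_tuple (tuple_cons (t, y)) = tuple_cons (t `^ theta, power_tuple y).
Proof. exact/val_inj. Qed.

Lemma prod_tuple_cons n (w : RR -> RR) t (y : n.-tuple RR) :
  \prod_k w (tnth (tuple_cons (t, y)) k) = w t * \prod_k w (tnth y k).
Proof.
rewrite big_ord_recl; congr (_ * _); apply: eq_bigr => k _.
by rewrite tnth_tuple_consS.
Qed.

(** One coordinate at a time: the induction hypothesis changes the variables
    y with t fixed, then [ge0_integral_power] changes t. *)
Lemma ge0_integral_lebesgue_tuple_power n (G : n.-tuple RR -> \bar R) :
  measurable_fun setT G -> (forall x, (0 <= G x)%E) ->
  (\int[lebesgue_tuple R n]_x ((\prod_k pos_indic (tnth x k))%:E * G x) =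
   \int[lebesgue_tuple R n]_x ((\prod_k power_weight (tnth x k))%:E *
     G (power_tuple x)))%E.
Proof.
elim: n G => [|n IH] G mG G0.
  apply: eq_integral => x _; rewrite !big_ord0; congr (_ * G _)%E.
  by apply/eq_from_tnth => -[].
have mI m := measurable_tuple_prod m _ measurable_pos_indic.
have mW m := measurable_tuple_prod m _ measurable_power_weight.
have pI m (x : m.-tuple RR) : (0 <= (\prod_k pos_indic (tnth x k))%:E)%E.
  by rewrite lee_fin prodr_ge0// => k _; exact: pos_indic_ge0.
have pW m (x : m.-tuple RR) : (0 <= (\prod_k power_weight (tnth x k))%:E)%E.
  by rewrite lee_fin prodr_ge0// => k _; exact: power_weight_ge0.
have mGp : measurable_fun setT (fun x => G (power_tuple x)).
  by apply: measurableT_comp => //; exact: measurable_power_tuple.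
have mcons t : measurable_fun setT (fun y : n.-tuple RR => tuple_cons (t, y)).
  by apply: measurableT_comp; [exact: measurable_tuple_cons|exact: measurable_pair1].
have mGt t : measurable_fun setT (fun y : n.-tuple RR => G (tuple_cons (t, y))).
  by apply: measurableT_comp => //; exact: mcons.
pose Phi t := (\int[lebesgue_tuple R n]_y ((\prod_k power_weight (tnth y k))%:E *
  G (tuple_cons (t, power_tuple y))))%E.
have mPhi : measurable_fun (setT : set RR) Phi.
  pose F (p : RR * n.-tuple RR) := ((\prod_k power_weight (tnth p.2 k))%:E *
    G (tuple_cons (p.1, power_tuple p.2)))%E.
  apply: (@measurable_fun_fubini_tonelli_F _ _ _ _ _ (lebesgue_tuple R n) F).
  - apply: emeasurable_funM.
      exact: (measurableT_comp (mW n) measurable_snd).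
    apply: measurableT_comp => //; apply: measurableT_comp.
      exact: measurable_tuple_cons.
    apply/measurable_fun_pairP; split; first exact: measurable_fst.
    exact: (measurableT_comp (measurable_power_tuple n) measurable_snd).
  - by move=> p; rewrite mule_ge0.
have Phi0 t : (0 <= Phi t)%E by apply: integral_ge0 => y _; rewrite mule_ge0.
rewrite !ge0_integral_lebesgue_tupleS; last 4 first.
- by apply: emeasurable_funM; [exact: mW|exact: mGp].
- by move=> x; rewrite mule_ge0.
- by apply: emeasurable_funM; [exact: mI|exact: mG].
- by move=> x; rewrite mule_ge0.
transitivity (\int[mu]_t ((pos_indic t)%:E * Phi t))%E.
  apply: eq_integral => t _; rewrite /Phi -(IH (fun y => G (tuple_cons (t, y))))//
    -ge0_integralZl//.
  - by apply: eq_integral => y _; rewrite prod_tuple_cons EFinM muleA.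
  - by apply: emeasurable_funM; [exact: mI|exact: mGt].
  - by move=> y _; rewrite mule_ge0.
  - by rewrite lee_fin pos_indic_ge0.
rewrite ge0_integral_power//; apply: eq_integral => t _;
  rewrite /Phi -ge0_integralZl//.
- by apply: eq_integral => y _; rewrite prod_tuple_cons EFinM muleA power_tuple_cons.
- apply: emeasurable_funM; first exact: mW.
  exact: (measurableT_comp (mGt (t `^ theta)) (measurable_power_tuple n)).
- by move=> y _; rewrite mule_ge0.
- by rewrite lee_fin power_weight_ge0.
Qed.

End power_substitution.

(** * The symmetry of the limit *)
Section left_edge_symmetry.
Variable R : realType.
Variables (alpha theta : R).
Hypotheses (alpha_gtN1 : -1 < alpha) (theta_gt0 : 0 < theta).
Notation RR := (measurableTypeR R).
Let alpha' := (alpha + 1) / theta - 1.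
Let theta' := 1 / theta.
Let a_gt0 : 0 < alpha + 1. Proof. by rewrite -ltrBlDr sub0r. Qed.
Let alpha'_gtN1 : -1 < alpha'.
Proof. by rewrite /alpha' ltrBDr addNr divr_gt0. Qed.
Let theta'_gt0 : 0 < theta'. Proof. by rewrite divr_gt0. Qed.

(** The new parameters are (a', theta') = (a / theta, 1 / theta), so nodes and
    dual nodes are exchanged; the factor theta comes from
    s_i + l = theta (z_l + i). *)
Lemma edge_term_swap (x y : R) i l :
  edge_term R (alpha' + 1) theta' y x i l =
  theta^-1 * edge_term R (alpha + 1) theta x y l i.
Proof.
have thn0 : theta != 0 by rewrite gt_eqF.
have nodeE : node R (alpha' + 1) theta' i = dual_node R (alpha + 1) theta i.
  by rewrite /node /dual_node /alpha' /theta'; field.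
have dualE : dual_node R (alpha' + 1) theta' l = node R (alpha + 1) theta l.
  by rewrite /node /dual_node /alpha' /theta'; field.
rewrite /edge_term nodeE dualE.
have -> : dual_node R (alpha + 1) theta i + l%:R =
  theta * (node R (alpha + 1) theta l + i%:R).
  by rewrite /node /dual_node; field.
have rearrange (A B t c : R) : A * B / (t * c) = t^-1 * (B * A / c).
  by rewrite invfM mulrCA [A * B]mulrC.
by rewrite rearrange.
Qed.

(** The substitution x^theta makes the second variable of the new kernel the
    plain variable y; the two kernels then have proportional partial sums,
    since these run over squares. *)
Lemma edge_kernel_swap (x y : R) : 0 < x -> 0 < y ->
  edge_kernel R (alpha' + 1) theta' (x `^ theta) (y `^ theta) =
  theta^-1 * edge_kernel R (alpha + 1) theta y x.
Proof.
move=> x0 y0; rewrite /edge_kernel.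
have -> : (y `^ theta) `^ theta' = y.
  by rewrite -powRrM /theta' mul1r divff ?gt_eqF// powRr1// ltW.
have [cs _] := scaled_sums_cvg R (alpha + 1) theta a_gt0 theta_gt0 y (x `^ theta)
  (ltW y0) (powR_ge0 _ _).
have -> : square_sum R (edge_term R (alpha' + 1) theta' (x `^ theta) y) =
  (fun M => theta^-1 * square_sum R (edge_term R (alpha + 1) theta y (x `^ theta)) M).
  apply/funext => M; rewrite /square_sum exchange_big big_distrr/=.
  apply: eq_bigr => l _; rewrite big_distrr/=; apply: eq_bigr => i _.
  exact: edge_term_swap.
by apply/cvg_lim => //; apply: cvgMr.
Qed.

(** Powers of theta: theta^(-n) from the kernels, theta^n from the Jacobian.
    Powers of x_k: theta - 1 + theta alpha' = alpha. *)
Lemma edge_correlation_swap n (x : n.-tuple RR) : (forall k, 0 < tnth x k) ->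
  (\prod_k power_weight R theta (tnth x k)) *
    edge_correlation R alpha' theta' n (power_tuple R theta n x) =
  edge_correlation R alpha theta n x.
Proof.
move=> x0; rewrite /edge_correlation.
have -> : \matrix_(i, j) edge_kernel R (alpha' + 1) theta'
    (tnth (power_tuple R theta n x) i) (tnth (power_tuple R theta n x) j) =
  theta^-1 *: (\matrix_(i, j) edge_kernel R (alpha + 1) theta (tnth x i)
    (tnth x j))^T.
  by apply/matrixP => i j; rewrite !mxE !tnth_map edge_kernel_swap.
rewrite detZ det_tr !mulrA; congr (_ * _).
have -> : theta^-1 ^+ n = \prod_(k < n) theta^-1 by rewrite prodr_const card_ord.
rewrite -!big_split/=; apply: eq_bigr => k _.
rewrite tnth_map /power_weight /pos_indic x0 mul1r -powRrM.
have -> : theta * tnth x k `^ (theta - 1) * tnth x k `^ (theta * alpha') / theta =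
  tnth x k `^ (theta - 1) * tnth x k `^ (theta * alpha').
  by rewrite -!mulrA mulrC -!mulrA mulVf ?gt_eqF// mulr1.
rewrite -powRD ?(gt_eqF (x0 k)) ?implybT//; congr (_ `^ _).
by rewrite /alpha'; field; rewrite gt_eqF.
Qed.

Lemma prod_pos_indic n (x : n.-tuple RR) :
  \prod_k pos_indic R (tnth x k) = (x \in orthant R n)%:R.
Proof.
case: (boolP (x \in orthant R n)) => [|].
  by rewrite inE => x0; rewrite big1// => k _; rewrite /pos_indic x0.
rewrite notin_setE => /existsNP[k /negP xk].
by rewrite (bigD1 k)//= /pos_indic (negbTE xk) mul0r.
Qed.

Lemma measurable_orthant n : measurable (orthant R n).
Proof.
have -> : orthant R n = (fun x : n.-tuple RR => (\prod_k pos_indic R (tnth x k))%:E)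
  @^-1` [set 1%E].
  apply/seteqP; split => x /=; rewrite prod_pos_indic.
    by move=> x0; rewrite mem_set.
  by case: (boolP (x \in orthant R n)) => [/set_mem//|_ /eqP];
    rewrite eqe eq_sym oner_eq0.
rewrite -[X in measurable X]setTI.
by apply: (measurable_tuple_prod R n _ (measurable_pos_indic R)).
Qed.

Lemma Lag_edge_measureE (be th : R) n (A : set (n.-tuple RR)) : -1 < be -> 0 < th ->
  Lag_edge_measure be th A =
  (\int[lebesgue_tuple R n]_x
     ((fun x => (edge_correlation R be th n x)%:E) \_ (A `&` orthant R n)) x)%E.
Proof.
move=> be1 th0; rewrite /Lag_edge_measure -integral_mkcond.
apply: eq_integral => x; rewrite inE => -[_ x0].
by rewrite Lag_edge_correlationE.
Qed.

(** The substitution x = y^theta in the integral over the preimage of A: on the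
    orthant it inverts the map of the statement, so the domain becomes A. *)
Lemma image_Lag_edge_measure n (A : set (n.-tuple RR)) : measurable A ->
  pushforward (@Lag_edge_measure R alpha' theta' n)
    (map_tuple (fun x : R => x `^ theta')) A
  = @Lag_edge_measure R alpha theta n A.
Proof.
move=> mA; rewrite /pushforward.
rewrite (Lag_edge_measureE _ _ n _ alpha'_gtN1 theta'_gt0).
rewrite (Lag_edge_measureE _ _ n A alpha_gtN1 theta_gt0).
set D := (X in X `&` _).
have mD : measurable (D `&` orthant R n).
  apply: measurableI; last exact: measurable_orthant.
  rewrite -[D]setTI; exact: (measurable_power_tuple R theta' n).
pose G := (fun x : n.-tuple RR => (edge_correlation R alpha' theta' n x)%:E) \_
  (D `&` orthant R n).
have mG : measurable_fun setT G.
  apply/(measurable_restrictT _ mD); apply/measurable_EFinP.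
  apply: (measurable_funS (measurable_orthant n)); first exact: subIsetr.
  exact: measurable_edge_correlation.
have G0 x : (0 <= G x)%E.
  rewrite /G patchE; case: ifPn => //; rewrite inE => -[_ x0].
  by rewrite lee_fin edge_correlation_ge0.
rewrite -/G.
transitivity (\int[lebesgue_tuple R n]_x ((\prod_k pos_indic R (tnth x k))%:E *
  G x))%E.
  apply: eq_integral => x _; rewrite prod_pos_indic /G patchE in_setI.
  by case: (x \in orthant R n); rewrite ?mul1e// andbF mul0e.
rewrite (ge0_integral_lebesgue_tuple_power R theta theta_gt0)//.
apply: eq_integral => x _; rewrite [RHS]patchE in_setI.
have [xo|xo] := boolP (x \in orthant R n); last first.
  move: xo; rewrite andbF notin_setE => /existsNP[k /negP xk].
  by rewrite (bigD1 k)//= /power_weight/pos_indic (negbTE xk) !mul0r mul0e.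
have x0 : forall k, 0 < tnth x k by move: xo; rewrite inE.
have px0 : power_tuple R theta n x \in orthant R n.
  by rewrite inE => k; rewrite tnth_map powR_gt0.
have pxx : map_tuple (fun t : R => t `^ theta') (power_tuple R theta n x) = x.
  apply/eq_from_tnth => k; rewrite !tnth_map -powRrM /theta' mul1r divff ?gt_eqF//.
  by rewrite powRr1// ltW.
rewrite /G patchE in_setI px0 !andbT.
have -> : (power_tuple R theta n x \in D) = (x \in A).
  by apply/idP/idP; rewrite !inE /D/= pxx.
by case: ifP; rewrite ?mule0// -EFinM edge_correlation_swap.
Qed.

End left_edge_symmetry.

Theorem corollary4p7 (R : realType) (alpha theta : R) (n : nat)
    (theta_gt0 : 0 < theta) (alpha_gtN1 : -1 < alpha) (n_ge1 : (1 <= n)%N)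
    (A : set (n.-tuple (measurableTypeR R))) (mA : measurable A) :
  let alpha' := (alpha + 1) / theta - 1 in
  let theta' := 1 / theta in
  pushforward (@Lag_edge_measure R alpha' theta' n)
    (map_tuple (fun x : R => x `^ (1 / theta))) A
  = @Lag_edge_measure R alpha theta n A.
Proof. exact: image_Lag_edge_measure. Qed.
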